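(* Let $G$ be a semi-2-tree on $n$ vertices with skeleton $T$, let $b(G)$ be the number of blocks of $G$ and $e(T)$ the number of edges of $T$, and let $t\ge 1$ be an integer. If $r$ is a simplicial vertex or a cut-vertex of $G$, then $$\pi_t(G,r)=\pi_t(T,r)+(n-1)+b(G)-2e(T).$$
   Context: Graphs are finite, simple and connected. A configuration on $G$ is a function $C:V(G)\to\mathbb{N}=\{0,1,\dots\}$; its size is $|C|=\sum_{v}C(v)$. A pebbling step from $u$ to an adjacent vertex $v$ removes two pebbles from $u$ and adds one pebble to $v$. $C$ is $t$-fold $r$-solvable if some (possibly empty) sequence of pebbling steps starting from $C$ places at least $t$ pebbles on $r$. $\pi_t(G,r)$ is the minimum $s$ such that every configuration of size at least $s$ is $t$-fold $r$-solvable; $\pi_t(T,r)$ is the same quantity for the tree $T$. A vertex is simplicial if its neighbors form a complete graph, and 2-simplicial if in addition it has degree 2. A 2-tree is a graph that is either $K_2$ or has a 2-simplicial vertex $v$ such that $G-v$ is a 2-tree. A 2-path is a 2-tree with exactly two simplicial vertices (in particular $K_2$ is a 2-path). A semi-2-tree is a (connected) graph in which each block is a 2-path, with each cut-vertex being simplicial in all of the blocks that contain it. Spine of a 2-path $H$: if $\mathrm{diam}(H)=1$ it is $H$ itself. If $H$ has simplicial vertices $a,b$ and $d=\mathrm{dist}(a,b)=\mathrm{diam}(H)\ge 2$, a spine is a shortest $ab$-path $P=x_0,x_1,\dots,x_d$ ($x_0=a$, $x_d=b$) such that: (i) for every $1\le i\le d-1$ there is a subgraph $F_i$ of $H$ (a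 fan centered on $x_i$) consisting of the path $x_{i-1},x_i,x_{i+1}$, a path $x_{i-1},v_{i,1},\dots,v_{i,k_i},x_{i+1}$ with $k_i\ge 1$, and all edges from $x_i$ to the vertices of that path; write $F_i'=\{v_{i,1},\dots,v_{i,k_i}\}$; (ii) for every $1\le i\le d-2$, either $F_i'\cap F_{i+1}'=\emptyset$, or $F_i'\cap F_{i+1}'=\{v_{i,k_i}\}$ and $v_{i,k_i}=v_{i+1,1}$; (iii) $H$ is the union of the $F_i$. Every 2-path has a spine. A skeleton $T$ of a semi-2-tree $G$ is the union of spines of its blocks (one spine for each block); it is a tree containing all simplicial vertices and cut-vertices of $G$. *)

(* Defs.v *)
From HB Require Import structures.
From mathcomp Require Import all_boot all_order all_algebra.
From mathcomp Require Import boolp.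

Set Implicit Arguments.
Unset Strict Implicit.
Unset Printing Implicit Defensive.

Section Graphs.
Variable V : finType.

(* Finite simple graphs whose vertices are taken in an ambient finite type V;
   edges are 2-element subsets of the vertex set.  Keeping the vertex set as a
   field lets a graph, its blocks, its spines and its skeleton share one type. *)
Definition wf_graph (g : {set V} * {set {set V}}) : bool :=
  [forall e in g.2, (#|e| == 2) && (e \subset g.1)].

Record sgraph := SGraph { gdata : {set V} * {set {set V}}; _ : wf_graph gdata }.

HB.instance Definition _ := [isSub for gdata].
HB.instance Definition _ := [Finite of sgraph by <:].

Definition vset (G : sgraph) : {set V} := (gdata G).1.
Definition eset (G : sgraph) : {set {set V}} := (gdata G).2.

Lemma mkgraph_wf (A : {set V}) (E : {set {set V}}) :
  wf_graph (A, [set e in E | (#|e| == 2) && (e \subset A)]).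
Proof. by apply/forall_inP => e /=; rewrite inE => /andP[]. Qed.

(* Members of E that are not 2-element subsets of A are discarded. *)
Definition mkgraph (A : {set V}) (E : {set {set V}}) : sgraph :=
  SGraph (mkgraph_wf A E).

Implicit Types (G H B S T F : sgraph) (u v w r a b c : V).

Definition adj G : rel V := fun u v => [set u; v] \in eset G.

Definition neighbors G v : {set V} := [set u | adj G v u].

Definition subgraph H G : bool := (vset H \subset vset G) && (eset H \subset eset G).

Definition del_vertex G v : sgraph := mkgraph (vset G :\ v) (eset G).

Definition union_graph (s : seq sgraph) : sgraph :=
  mkgraph (\bigcup_(H <- s) vset H) (\bigcup_(H <- s) eset H).

Definition connected G : bool :=
  (vset G != set0) && [forall u in vset G, forall v in vset G, connect (adj G) u v].

(* Deleting v disconnects two other vertices of the same component. *)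
Definition cut_vertex G v : bool :=
  (v \in vset G) &&
  [exists x in vset G :\ v, exists y in vset G :\ v,
     connect (adj G) x y && ~~ connect (adj (del_vertex G v)) x y].

Definition nonseparable G : bool := connected G && [forall v, ~~ cut_vertex G v].

(* In particular the only block of a one-vertex graph is the graph itself. *)
Definition block G B : bool :=
  [&& subgraph B G, nonseparable B &
      [forall B' : sgraph,
         [&& subgraph B' G, nonseparable B' & subgraph B B'] ==> (B' == B)]].

Definition blocks G : {set sgraph} := [set B | block G B].

Definition simplicial G v : bool :=
  (v \in vset G) &&
  [forall u in neighbors G v, forall w in neighbors G v, (u != w) ==> adj G u w].

Definition simplicial2 G v : bool := simplicial G v && (#|neighbors G v| == 2).

Inductive two_tree : sgraph -> Prop :=
| two_tree_K2 G : #|vset G| = 2 -> #|eset G| = 1 -> two_tree G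
| two_tree_add G v : simplicial2 G v -> two_tree (del_vertex G v) -> two_tree G.

Definition two_path G : Prop :=
  two_tree G /\ #|[set v | simplicial G v]| = 2.

Definition semi_two_tree G : Prop :=
  [/\ connected G,
      forall B, B \in blocks G -> two_path B &
      forall v B, cut_vertex G v -> B \in blocks G -> v \in vset B ->
        simplicial B v].

Definition has_walk G u v (k : nat) : bool :=
  [exists p : k.-tuple V, path (adj G) u p && (last u p == v)].

(* Least length of a walk; the value is the out-of-range #|V|.+1 when u and v
   lie in different components. *)
Definition dist G u v : nat := find (has_walk G u v) (iota 0 #|V|.+1).

Definition diam G : nat := \max_(u in vset G) \max_(v in vset G) dist G u v.

Definition path_edges (s : seq V) : {set {set V}} :=
  [set:: [seq [set q.1; q.2] | q <- zip s (behead s)]].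

Definition path_graph (s : seq V) : sgraph := mkgraph [set:: s] (path_edges s).

(* The path s together with a vertex c joined to every vertex of s. *)
Definition fan (c : V) (s : seq V) : sgraph :=
  mkgraph (c |: [set:: s]) (path_edges s :|: [set [set c; w] | w in [set:: s]]).

(* With x_0 = a and xs = x_1, ..., x_d, the list vs i enumerates
   v_{i,1}, ..., v_{i,k_i} for 1 <= i <= d - 1; its other values are unused.
   The last vertex of vs i and the first of vs i.+1 are compared through
   defaults that are never reached, these lists being nonempty. *)
Definition spine H S : Prop :=
  (diam H = 1 /\ S = H) \/
  exists a b (xs : seq V) (vs : nat -> seq V),
    let d := dist H a b in
    let x i := nth a (a :: xs) i in
    let rim i := x i.-1 :: rcons (vs i) (x i.+1) in
    let Fan i := fan (x i) (rim i) in
    let F' i : {set V} := [set:: vs i] in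
    [/\ [/\ simplicial H a, simplicial H b, d = diam H & 2 <= d],
        [/\ path (adj H) a xs, last a xs = b & size xs = d],
        forall i, 1 <= i < d ->
          [/\ 1 <= size (vs i), uniq (x i :: rim i) & subgraph (Fan i) H],
        forall i, 1 <= i -> i <= d - 2 ->
          F' i :&: F' i.+1 = set0 \/
          F' i :&: F' i.+1 = [set last a (vs i)] /\
            last a (vs i) = head a (vs i.+1) &
        H = union_graph [seq Fan i | i <- iota 1 d.-1]
        /\ S = path_graph (a :: xs)].

Definition skeleton G T : Prop :=
  exists sp : sgraph -> sgraph,
    (forall B, B \in blocks G -> spine B (sp B)) /\
    T = union_graph [seq sp B | B in blocks G].

(* A configuration on G is a function on V(G), extended by 0 to V. *)
Definition config := {ffun V -> nat}.

Definition config_on G (C : config) : bool :=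
  [forall v, (C v != 0) ==> (v \in vset G)].

Definition csize (C : config) : nat := \sum_v C v.

Definition pebble_step G : rel config := fun C C' =>
  [exists u, exists v,
     [&& adj G u v, 2 <= C u &
         C' == [ffun w => C w - 2 * (w == u) + (w == v)]]].

Definition solvable G (t : nat) r (C : config) : Prop :=
  exists2 Cs : seq config, path (pebble_step G) C Cs & t <= last C Cs r.

Definition solvable_from G (t : nat) r (s : nat) : Prop :=
  forall C, config_on G C -> s <= csize C -> solvable G t r C.

(* The minimum exists when G is connected and contains r, see
   pebbling_numberP; it is set to 0 when no s qualifies. *)
Definition pebbling_number G (t : nat) r : nat :=
  match pselect (exists s, `[< solvable_from G t r s >]) with
  | left exs => ex_minn exs
  | right _ => 0
  end.

Lemma adjP G u v : adj G u v -> [/\ u != v, u \in vset G & v \in vset G].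
Proof.
case: G => -[A E] wf; rewrite /adj /vset /eset /= => uvE.
have /forall_inP/(_ _ uvE) /= := wf.
by rewrite cards2 subUset !sub1set => /and3P[]; case: (u != v).
Qed.

Lemma move_along_edge G (C : config) u v m : adj G u v -> 2 * m <= C u ->
  exists2 Cs, path (pebble_step G) C Cs & m <= last C Cs v.
Proof.
move=> uv mC; have [nuv _ _] := adjP uv.
suff [Cs pCs ge_v]: exists2 Cs, path (pebble_step G) C Cs
    & m + C v <= last C Cs v.
  by exists Cs => //; apply: leq_trans ge_v; rewrite leq_addr.
elim: m C mC => [|m IHm] C mC; first by exists [::].
set D : config := [ffun w => C w - 2 * (w == u) + (w == v)].
have stD : pebble_step G C D.
  apply/existsP; exists u; apply/existsP; exists v; rewrite uv eqxx andbT /=.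
  by apply: leq_trans mC; rewrite mulnS leq_addr.
have DuE : 2 * m <= D u.
  rewrite ffunE eqxx (negbTE nuv) muln1 addn0 leq_subRL; first by rewrite -mulnS.
  by rewrite (leq_trans _ mC) // mulnS leq_addr.
have [Cs pCs geD] := IHm D DuE.
exists (D :: Cs); first by rewrite /= stD.
apply: leq_trans geD; rewrite ffunE eqxx eq_sym (negbTE nuv) muln0 subn0.
by rewrite addn1 addnS.
Qed.

Lemma move_along_path G (C : config) u p t :
  path (adj G) u p -> t * 2 ^ size p <= C u -> solvable G t (last u p) C.
Proof.
elim: p u C => [|v p IHp] u C /=; first by rewrite muln1; exists [::].
case/andP=> uv pv le_u.
have [|Cs pCs le_v] := @move_along_edge G C u v (t * 2 ^ size p) uv.
  by rewrite mulnCA -expnS.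
have [Ds pDs le_r] := IHp v _ pv le_v.
by exists (Cs ++ Ds); rewrite ?cat_path ?pCs // last_cat.
Qed.

Lemma solvable_from_exists G t r : connected G -> r \in vset G ->
  exists s, solvable_from G t r s.
Proof.
case/andP=> _ /forall_inP conn rG.
exists (#|V| * (t * 2 ^ #|V|)).+1 => C /forallP onG big.
have [/existsP[v le_v]|/existsPn lt_all] :=
    boolP [exists v, (t * 2 ^ #|V| < C v)%N]; last first.
  suff: csize C <= #|V| * (t * 2 ^ #|V|) by rewrite leqNgt big.
  rewrite -sum_nat_const; apply: leq_sum => v _.
  by rewrite leqNgt lt_all.
have vG : v \in vset G.
  by apply: (implyP (onG v)); rewrite -lt0n; apply: leq_ltn_trans le_v.
have /connectP[p0 pp0 ->] := forall_inP (conn v vG) r rG.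
case: (shortenP pp0) => p pp up _; apply: move_along_path => //.
apply: leq_trans (ltnW le_v); rewrite leq_mul // leq_exp2l //.
by apply: ltnW; move/card_uniqP: up => /= <-; apply: max_card.
Qed.

Lemma pebbling_numberP G t r : connected G -> r \in vset G ->
  solvable_from G t r (pebbling_number G t r) /\
  forall s, solvable_from G t r s -> pebbling_number G t r <= s.
Proof.
move=> cG rG; rewrite /pebbling_number; case: pselect => [exs|[]]; last first.
  by have [s ps] := solvable_from_exists t cG rG; exists s; apply/asboolP.
case: ex_minnP => m /asboolP pm minm; split=> // s ps.
by apply: minm; apply/asboolP.
Qed.

End Graphs.

(* Main.v *)
(* Root [G] at [r] and cut every block into its breadth-first levels from the
   vertex where it is attached.  In a 2-path all vertices of a level are adjacent
   to one vertex of the level above, its hub, and edges between consecutive levels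
   reach the level above only in the hub or in one further vertex, its mate.

   Lower bound: merging each hub with its mate turns [G] into a tree, namely the
   skeleton (up to renaming) with a pendant vertex for every vertex that is neither
   a hub nor a mate, and a potential shows that pebbling in [G] is no stronger than
   in this tree.  Upper bound: collapsing greedily the deepest level onto the hub
   above is pebbling in the breadth-first tree, in which the mates are pendant as
   well; one pebble is saved for each mate because a pebble can also be brought to
   the mate above by walking along the level.

   Both bounds are the pebbling number of a tree plus the number of remaining
   pendant vertices.  The skeleton is an instance of the same structure, with
   one-vertex levels, and its tree has the same shape as that of [G]. *)
Require Import Defs.
From mathcomp Require Import all_boot all_order all_algebra zify.
From mathcomp Require Import boolp.

Set Implicit Arguments.
Unset Strict Implicit.
Unset Printing Implicit Defensive.

Import GRing.Theory.

(** * Derivable configurations *)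

(** The constant in the formula is a count. Besides the vertex where it is attached, a block with k
    levels has 2k - 1 hubs and mates, since its last level has no mate, and its spine has k edges.
    Summed over the blocks, this leaves (n-1) + b(G) - 2e(T) pendant vertices.

    No closed formula for the pebbling number of a tree is used. Peeling off the deepest level turns
    its value into a weight on the hub above. A chain of levels acts on the weights only through its
    length and the weight of its far end, so the levels of G and those of T have equal cost.

    The obstacle is the upper bound. A greedy collapse counts one pebble too many for each mate, and
    whether this pebble can be saved at once depends on parities. The induction therefore carries
    two bounds: one with a defect of 1 for every unsolvable configuration, and a sharp one for
    configurations that remain unsolvable when a pebble of an odd hub is handed to its mate. *)

Lemma half_pred_odd n : odd n -> n.-1./2 = n./2.
Proof. by case: n => //= n; rewrite uphalf_half => /negbTE->. Qed.

Section Derivations.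
Variables (V : finType) (G : sgraph V).
Implicit Types (C D : config V) (u v w : V).

(** Reachability up to discarding pebbles. Since surplus pebbles never hurt, lower estimates of
    reached configurations can be composed. *)
Definition derives C D :=
  exists2 Cs, path (pebble_step G) C Cs & forall v, D v <= last C Cs v.

Lemma adjC u v : adj G u v = adj G v u.
Proof. by rewrite /adj setUC. Qed.

Lemma adj_neq u v : adj G u v -> u != v.
Proof. by case/adjP. Qed.

Lemma pebble_step_mono C C' D :
  pebble_step G C C' -> (forall v, C v <= D v) ->
  exists2 D', pebble_step G D D' & forall v, C' v <= D' v.
Proof.
case/existsP=> u /existsP[v /and3P[uv Cu /eqP->]] CD.
exists [ffun w => D w - 2 * (w == u) + (w == v)].
  by apply/existsP; exists u; apply/existsP; exists v; rewrite uv eqxx (leq_trans Cu).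
by move=> w; rewrite !ffunE leq_add2r leq_sub2r.
Qed.

Lemma path_mono Cs C D :
  path (pebble_step G) C Cs -> (forall v, C v <= D v) ->
  exists2 Ds, path (pebble_step G) D Ds & forall v, last C Cs v <= last D Ds v.
Proof.
elim: Cs C D => [|C' Cs IH] C D /=; first by exists [::].
case/andP=> CC' pCs CD; have [D' DD' CD'] := pebble_step_mono CC' CD.
by have [Ds pDs le] := IH _ _ pCs CD'; exists (D' :: Ds); rewrite //= DD'.
Qed.

Lemma derives_refl C D : (forall v, D v <= C v) -> derives C D.
Proof. by exists [::]. Qed.

Lemma derives_trans C D E : derives C D -> derives D E -> derives C E.
Proof.
case=> Cs pCs leC [Ds pDs leD].
have [Es pEs leE] := path_mono pDs leC.
exists (Cs ++ Es); first by rewrite cat_path pCs.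
by move=> v; rewrite last_cat (leq_trans (leD v)).
Qed.

Lemma derives_solvable t r C D :
  derives C D -> solvable G t r D -> solvable G t r C.
Proof.
case=> Cs pCs leC [Ds pDs tD]; have [Es pEs leE] := path_mono pDs leC.
exists (Cs ++ Es); first by rewrite cat_path pCs.
by rewrite last_cat (leq_trans tD).
Qed.

Lemma derives_move u v m C D : adj G u v -> 2 * m <= C u ->
  (forall w, D w <= C w - 2 * m * (w == u) + m * (w == v)) -> derives C D.
Proof.
move=> uv; have nuv := adj_neq uv.
elim: m C D => [|m IH] C D mC leD.
  by apply: derives_refl => w; move: (leD w); rewrite !mul0n subn0 addn0.
pose C' : config V := [ffun w => C w - 2 * (w == u) + (w == v)].
apply: (@derives_trans _ C').
  exists [:: C'] => //=; rewrite andbT; apply/existsP; exists u; apply/existsP.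
  by exists v; rewrite uv eqxx andbT; lia.
apply: IH => [|w]; first by rewrite ffunE eqxx (negbTE nuv); lia.
rewrite ffunE; move: (leD w); case: eqP => [->|_]; rewrite ?(negbTE nuv); last by lia.
by lia.
Qed.

Definition collapse (L : seq V) p C : config V :=
  [ffun v => if v \in L then 0 else C v + (v == p) * \sum_(u <- L) (C u)./2].

Lemma derives_collapse L p C :
  uniq L -> p \notin L -> all (adj G p) L -> derives C (collapse L p C).
Proof.
elim: L C => [|u L IH] C /=.
  by move=> _ _ _; apply: derives_refl => v; rewrite ffunE big_nil muln0 addn0.
case/andP=> uL uniqL; rewrite inE negb_or => /andP[npu pL] /andP[pu aL].
pose C' : config V := [ffun w => C w - 2 * (C u)./2 * (w == u) + (C u)./2 * (w == p)].
apply: (@derives_trans _ C').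
  apply: (@derives_move u p (C u)./2); first by rewrite adjC.
    by lia.
  by move=> w; rewrite ffunE.
apply: derives_trans (IH C' uniqL pL aL) _; apply: derives_refl => v.
rewrite !ffunE inE; case: (eqVneq v u) => [->|nvu] //=.
case: (v \in L) => //=; rewrite muln0 subn0 big_cons -addnA leq_add2l.
rewrite mulnDr [_ * (v == p)]mulnC leq_add2l leq_mul2l.
apply/orP; right; apply: eq_leq; apply: eq_big_seq => w wL; rewrite ffunE.
have nwu: w != u by apply: contraNneq uL => <-.
have nwp: w != p by apply: contraNneq pL => <-.
by rewrite (negbTE nwu) (negbTE nwp) !muln0 subn0 addn0.
Qed.

(** A relay along an occupied path: a pebble sent from [u] gives the next vertex a second one, so
    that it can send one on in turn. The induction removes the vertex next to [u]. *)
Lemma derives_rim y s u C :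
  path (adj G) y (rcons s u) -> uniq (y :: rcons s u) ->
  (forall v, v \in s -> 0 < C v) -> 2 <= C u ->
  derives C [ffun v => C v - (v \in s) - 2 * (v == u) + (v == y)].
Proof.
elim/last_ind: s u C => [|s w IH] u C.
  rewrite /= andbT => yu _ _ Cu.
  apply: (@derives_move u y 1); rewrite ?muln1 // 1?adjC // => v.
  by rewrite ffunE /= subn0 mul1n.
rewrite rcons_path last_rcons => /andP[pw wu] uq Cs Cu.
move: (uq); rewrite -rcons_cons rcons_uniq => /andP[uys uq'].
have nuw : u != w by apply: contraNneq uys => ->; rewrite inE mem_rcons inE eqxx orbT.
have nus : u \notin s.
  by apply: contra uys => us; rewrite inE mem_rcons inE us !orbT.
have nws : w \notin s.
  by move: uq'; rewrite -rcons_cons rcons_uniq inE negb_or => /andP[/andP[]].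
pose C' : config V := [ffun v => C v - 2 * (v == u) + (v == w)].
apply: (@derives_trans _ C').
  apply: (@derives_move u w 1); rewrite ?muln1 1?adjC // => v.
  by rewrite ffunE mul1n.
have Cw : 0 < C w by apply: Cs; rewrite mem_rcons inE eqxx.
apply: derives_trans (IH w C' pw uq' _ _) _.
- move=> v vs; rewrite ffunE.
  have nvu: v != u by apply: contraNneq nus => <-.
  by rewrite (negbTE nvu) muln0 subn0 addn_gt0 Cs // mem_rcons inE vs orbT.
- by rewrite ffunE eqxx eq_sym (negbTE nuw); lia.
apply: derives_refl => v; rewrite !ffunE mem_rcons inE leq_add2r.
case: (eqVneq v w) => [->|nvw] /=.
  by rewrite (negbTE nws) eq_sym (negbTE nuw); lia.
case: (eqVneq v u) => [->|nvu] /=; first by rewrite (negbTE nus) !subn0 ?muln1 ?addn0 ?subn0.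
by rewrite !muln0 !subn0 !addn0.
Qed.

(** The relay takes from the vertices of [s1] only the odd pebble that halving wastes anyway. The
    one real loss is the pair taken from [u], so one pebble due at [x] is exchanged for one at
    [y]. *)
Lemma derives_rim_collapse x y s1 u s2 C (L := s1 ++ u :: s2) :
  path (adj G) y L -> all (adj G x) L -> uniq (y :: L) -> x \notin L ->
  (forall v, v \in s1 -> odd (C v)) -> 2 <= C u -> x != y ->
  derives C [ffun v => collapse L x C v - (v == x) + (v == y)].
Proof.
move=> pL aL uL xL oC Cu nxy.
pose C' : config V := [ffun v => C v - (v \in s1) - 2 * (v == u) + (v == y)].
move: (uL) => /= /andP[yL uL'].
have [us1 us2] : u \notin s1 /\ u \notin s2.
  move: uL'; rewrite cat_uniq /= negb_or => /and3P[_ /andP[-> _]].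
  by case/andP.
apply: (@derives_trans _ C').
  apply: derives_rim => //.
  - by move: pL; rewrite /L -cat_rcons cat_path => /andP[].
  - by move: uL; rewrite /L -cat_rcons -cat_cons cat_uniq => /and3P[].
  - by move=> v /oC; case: (C v).
apply: derives_trans (derives_collapse _ uL' xL aL) _.
apply: derives_refl => v; rewrite !ffunE; case: ifP => [vL|/negbT vL].
  have nvx: v != x by apply: contraNneq xL => <-.
  have nvy: v != y by apply: contraNneq yL => <-.
  by rewrite (negbTE nvx) (negbTE nvy).
have nvs : v \notin s1 by apply: contra vL; rewrite mem_cat => ->.
have nvu : v != u by apply: contraNneq vL => ->; rewrite mem_cat inE eqxx orbT.
rewrite (negbTE nvs) (negbTE nvu).
suff -> : \sum_(w <- L) (C w)./2 = (\sum_(w <- L) (C' w)./2).+1.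
  rewrite !muln0 !subn0; case: (v == x); rewrite ?mul0n ?addn0 ?subn0 // !mul1n.
  by rewrite addnS subn1 /= addnAC.
rewrite !big_cat !big_cons /= -addnS -addSn; congr (_ + (_ + _)).
- apply: eq_big_seq => w ws.
  have nwu: w != u by apply: contraNneq us1 => <-.
  have nwy: w != y by apply: contraNneq yL => <-; rewrite mem_cat ws.
  rewrite ffunE ws (negbTE nwu) (negbTE nwy) muln0 subn0 addn0.
  by rewrite subn1 half_pred_odd ?oC.
- have nuy: u != y by apply: contraNneq yL => <-; rewrite mem_cat inE eqxx orbT.
  rewrite ffunE (negbTE us1) eqxx (negbTE nuy) muln1 subn0 addn0.
  by case: (C u) Cu => [|[|n]] //=; rewrite !subSS subn0.
- apply: eq_big_seq => w ws.
  have nwu: w != u by apply: contraNneq us2 => <-.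
  have nwy: w != y by apply: contraNneq yL => <-; rewrite mem_cat inE ws !orbT.
  have nws: w \notin s1.
    move: uL'; rewrite cat_uniq => /and3P[_ /hasPn/(_ w) + _]; apply.
    by rewrite inE ws orbT.
  by rewrite ffunE (negbTE nws) (negbTE nwu) (negbTE nwy) !subn0 addn0.
Qed.

End Derivations.

(** * Levels and the upper bound *)

(* [up] and [up'] are the hub and the mate of the level above, or both the
   vertex where the block is attached; a level without mate has [mate = hub].  All
   vertices of [layer] are adjacent to [up], and [up' :: layer] is a path. *)
Record level (V : Type) :=
  Level { up : V; up' : V; hub : V; mate : V; layer : seq V }.

Section Levels.
Variables (V : finType).
Implicit Types (en : level V) (lv : seq (level V)) (u v r : V) (w : V -> nat).

Definition verts r lv : seq V := r :: flatten [seq layer en | en <- lv].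

(** In [G] these are the root and the far simplicial vertices of the blocks, where further blocks
    may hang. In the skeleton, whose levels have no mates, they are all the vertices. *)
Definition nodes r lv : seq V :=
  r :: [seq hub en | en <- lv & hub en == mate en].

Definition sealed lv : bool := if lv is en :: _ then hub en == mate en else true.

(** The position of hub and mate at the end of the row matters when an empty mate blocks a relay: a
    vertex behind the mate can then only be the hub. *)
Definition ends_row en : Prop :=
  exists s, [\/ layer en = rcons s (hub en) /\ mate en = hub en,
                layer en = s ++ [:: hub en; mate en] /\ hub en != mate en |
                layer en = s ++ [:: mate en; hub en] /\ hub en != mate en].

(** Lists run from the newest level to the oldest. After an unsealed level its block must be
    continued from hub and mate; after a sealed one a new piece may hang at any node. *)
Definition attached r lv en : bool :=
  if sealed lv then (up en == up' en) && (up en \in nodes r lv) else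
  if lv is en0 :: _ then (up en == hub en0) && (up' en == mate en0) else false.

Fixpoint layered (e : rel V) r lv : Prop :=
  if lv is en :: lv' then
    [/\ uniq (layer en), {in layer en, forall v, v \notin verts r lv'},
        all (e (up en)) (layer en) /\ path e (up' en) (layer en),
        ends_row en /\ attached r lv' en & layered e r lv']
  else True.

Definition excess en : nat := size (layer en) - (hub en != mate en).+1.

Definition total_excess lv : nat := \sum_(en <- lv) excess en.

Definition reweight w en : V -> nat :=
  fun v => if v == up en then maxn (w v) (2 * w (hub en)) else w v.

(* In a tree an odd number 2k + 1 of pebbles on a leaf [c] is worth k pebbles on
   its parent [p]; hence, when [c] has weight [w c], a pebble on [p] may be traded
   for a total weight [2 * w c], apart from a constant [w c]. *)
Fixpoint cost (t : nat) r lv w : nat :=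
  if lv is en :: lv' then w (hub en) + cost t r lv' (reweight w en)
  else w r * t.-1.

Lemma ends_hub en : ends_row en -> hub en \in layer en.
Proof.
by case=> s [[-> _]|[-> _]|[-> _]]; rewrite ?mem_rcons ?mem_cat !inE eqxx ?orbT.
Qed.

Lemma ends_mate en : ends_row en -> mate en \in layer en.
Proof.
by case=> s [[-> ->]|[-> _]|[-> _]]; rewrite ?mem_rcons ?mem_cat !inE eqxx ?orbT.
Qed.

Lemma ends_size en : ends_row en ->
  size (layer en) = excess en + (hub en != mate en).+1.
Proof.
rewrite /excess; case=> s [[-> ->]|[-> ne]|[-> ne]].
- by rewrite size_rcons eqxx; lia.
- by rewrite size_cat ne /=; lia.
- by rewrite size_cat ne /=; lia.
Qed.

Lemma nodes_verts e r lv : layered e r lv -> {subset nodes r lv <= verts r lv}.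
Proof.
elim: lv => [_ v //|en lv IH] /= [_ _ _ [en_ends _] lay] v; rewrite /nodes /verts /=.
rewrite inE => /orP[/eqP->|]; first by rewrite inE eqxx.
case: ifP => _; rewrite ?inE; last first.
  move=> vn; have := IH lay v; rewrite !inE vn orbT => /(_ isT).
  by rewrite mem_cat => /orP[->|->]; rewrite ?orbT.
case/orP => [/eqP->|vn]; first by rewrite mem_cat ends_hub ?orbT.
have := IH lay v; rewrite !inE vn orbT => /(_ isT).
by rewrite mem_cat => /orP[->|->]; rewrite ?orbT.
Qed.

Lemma attached_verts e r lv en : layered e r lv -> attached r lv en ->
  up en \in verts r lv /\ up' en \in verts r lv.
Proof.
rewrite /attached; case: ifP => _ lay.
  by case/andP=> /eqP<- upn; split; apply: nodes_verts lay _ upn.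
case: lv lay => [|en0 lv] //= [_ _ _ [ee _] _] /andP[/eqP-> /eqP->].
by rewrite /verts /= !inE !mem_cat ends_hub ?ends_mate ?orbT.
Qed.

(** A pair on [v] weighs [2 * w v], at most the new weight of the pebble it becomes on [p]. The
    extra terms on the left measure waste: an even pile lacks the odd pebble worth [w v], and
    pebbles already on [p] gain weight. *)
Lemma weight_collapse (L : seq V) p w w1 (C : config V) :
  uniq L -> p \notin L -> (forall v, v != p -> w1 v = w v) -> w p <= w1 p ->
  (forall v, v \in L -> 2 * w v <= w1 p) ->
  \sum_v w v * C v + \sum_(v <- L) w v * ~~ odd (C v) + (w1 p - w p) * C p
    <= \sum_v w1 v * collapse L p C v + \sum_(v <- L) w v.
Proof.
move=> uL pL w1E wp wL.
rewrite (bigID (mem L)) [X in _ <= X + _](bigID (mem L)) /=.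
rewrite [X in _ <= X + _ + _]big1 => [|v vL]; last by rewrite ffunE vL muln0.
rewrite add0n [X in _ + X + _ + _ <= _](bigD1 p) // [X in _ <= X + _](bigD1 p) //=.
have -> : \sum_(v | (v \notin L) && (v != p)) w1 v * collapse L p C v
          = \sum_(v | (v \notin L) && (v != p)) w v * C v.
  apply: eq_bigr => v /andP[vL nvp].
  by rewrite ffunE (negbTE vL) (negbTE nvp) w1E // mul0n addn0.
rewrite ffunE (negbTE pL) eqxx mul1n -big_uniq //=.
suff le : \sum_(v <- L) w v * C v + \sum_(v <- L) w v * ~~ odd (C v)
    <= w1 p * \sum_(v <- L) (C v)./2 + \sum_(v <- L) w v.
  have e : w p * C p + (w1 p - w p) * C p = w1 p * C p by rewrite -mulnDl subnKC.
  by rewrite mulnDr; lia.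
rewrite big_distrr /= -!big_split /=.
rewrite big_seq [X in _ <= X]big_seq; apply: leq_sum => v /wL le.
rewrite -[X in w v * X + _]odd_double_half -mul2n.
rewrite mulnDr mulnA [w v * 2]mulnC addnAC -mulnDr addnC.
have -> : odd (C v) + ~~ odd (C v) = 1 by case: odd.
by rewrite muln1 leq_add2r leq_mul2r le orbT.
Qed.

End Levels.

(** * Unsolvable configurations under greedy collapse *)

Section UpperBound.
Variables (V : finType) (G : sgraph V) (t : nat) (r : V).
Implicit Types (en : level V) (lv : seq (level V)) (u v : V) (w : V -> nat).
Implicit Types C D : config V.

Local Notation unsolvable C := (~ solvable G t r C).

Definition swap_pebble C x y : config V := [ffun v => C v - (v == x) + (v == y)].

(* One pebble of the hub could have been brought to the mate instead.  When a
   level is collapsed, either one of its vertices holds an even number of pebbles,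
   which wastes one compared to the extremal configuration, or all its vertices
   are occupied and a pebble can walk along the level to the mate above. *)
Definition swappable lv C : Prop :=
  if lv is en :: _ then
    odd (C (hub en)) -> unsolvable (swap_pebble C (hub en) (mate en))
  else True.

Lemma swappable_sealed lv C : sealed lv -> unsolvable C -> swappable lv C.
Proof.
case: lv => //= en lv /eqP<- nC oC; suff -> : swap_pebble C (hub en) (hub en) = C by [].
apply/ffunP => v; rewrite ffunE; case: eqP => [->|]; last by rewrite subn0 addn0.
by rewrite subnK // odd_gt0.
Qed.

(** When the relay along the row can run, the collapse can deliver one of its pebbles to the mate
    above instead of the hub. The result is derivable from [C], hence no more solvable. *)
Lemma unsolvable_rim lv en C s1 u s2 : layered (adj G) r (en :: lv) ->
  ~~ sealed lv -> layer en = s1 ++ u :: s2 -> {in s1, forall v, odd (C v)} ->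
  2 <= C u -> unsolvable C ->
  unsolvable (swap_pebble (collapse (layer en) (up en) C) (up en) (up' en)).
Proof.
case=> uL disj [aL pL] [_ att] lay ncl eL os1 Cu nC solv; apply: nC.
have [upv upv'] := attached_verts lay att.
have upL : up en \notin layer en by apply/negP => /disj; rewrite upv.
have upL' : up' en \notin layer en by apply/negP => /disj; rewrite upv'.
apply: derives_solvable solv; rewrite eL; apply: derives_rim_collapse => //.
- by rewrite -eL.
- by rewrite -eL.
- by rewrite -eL /= upL'.
- by rewrite -eL.
- move: att; rewrite /attached (negbTE ncl); case: (lv) ncl => //= en0 _ ncl.
  by case/andP=> /eqP-> /eqP->.
Qed.

(** Rows start next to [up']. Taking the first heavy vertex, the relay from it to [up'] crosses only
    piles of at most one pebble. *)
Lemma heavy_split (s : seq V) C : 0 < \sum_(v <- s) (C v)./2 ->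
  exists s1 u s2, [/\ s = s1 ++ u :: s2, 2 <= C u & {in s1, forall v, C v < 2}].
Proof.
move=> pos; have : has (fun v => 2 <= C v) s.
  apply: contraTT pos => /hasPn lt2; rewrite -leqNgt leqn0 sum_nat_seq_eq0.
  by apply/allP => v /lt2; case: (C v) => [|[|]].
case/split_find=> u s1 s2 Cu /hasPn s1lt; exists s1, u, s2; split=> //.
  by rewrite cat_rcons.
by move=> v /s1lt; rewrite -ltnNge.
Qed.

(* A hub of an unsealed level that is not the deepest remaining one has a single
   child and has not been reweighted yet. *)
Definition weights_ok lv w : Prop :=
  [/\ forall v, 0 < w v,
      {in verts r lv, forall v, v \notin nodes r lv ->
         (if lv is en :: _ then v != hub en else true) -> w v = 1} &
      if lv is en :: _ then hub en != mate en -> 2 <= w (hub en) else True].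

Lemma reweight_ok lv en w : layered (adj G) r (en :: lv) ->
  weights_ok (en :: lv) w -> weights_ok lv (reweight w en).
Proof.
case=> uL disj _ [ee att] lay [w1 wE w2].
have w'1 v : 0 < reweight w en v.
  by rewrite /reweight; case: ifP => _; rewrite ?leq_max w1.
split=> //.
  move=> v vlv vn vh.
  have nvup : v != up en.
    apply: contraTneq att => ve; rewrite /attached -ve (negbTE vn) andbF.
    by case: (lv) vh => [|en0 ?] //= /negbTE->; case: ifP.
  have nvh : v != hub en.
    by apply/eqP => ve; have := disj _ (ends_hub ee); rewrite -ve vlv.
  rewrite /reweight (negbTE nvup); apply: wE => //.
    by move: vlv; rewrite !inE mem_cat => /orP[->|->]; rewrite ?orbT.
  move: vn; rewrite /nodes /=; case: ifP => // _.
  by rewrite !inE negb_or => /andP[/negbTE-> /negbTE->]; rewrite orbF nvh.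
case: (lv) att => //= en0 lv0; rewrite /attached /= => + ne.
rewrite (negbTE ne) => /andP[/eqP e _]; rewrite /reweight e eqxx leq_max.
by have := w1 (hub en); lia.
Qed.


Lemma hub_weights lv en w : layered (adj G) r (en :: lv) ->
  weights_ok (en :: lv) w ->
  \sum_(v <- layer en) w v = w (hub en) + excess en + (hub en != mate en).
Proof.
case=> uL disj _ [ee _] lay [_ wE _].
rewrite (big_rem (hub en)) ?ends_hub //= -addnA; congr (_ + _).
have -> : \sum_(v <- rem (hub en) (layer en)) w v
          = \sum_(v <- rem (hub en) (layer en)) 1.
  rewrite big_seq [RHS]big_seq; apply: eq_bigr => v.
  rewrite mem_rem_uniq // inE => /andP[nvh vL]; apply: wE => //.
    by rewrite /verts /= inE mem_cat vL orbT.
  have vn : v \notin nodes r lv by apply/negP => /(nodes_verts lay); apply/negP/disj.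
  move: vn; rewrite /nodes /=; case: ifP => //= _.
  by rewrite !inE !negb_or nvh.
by rewrite sum1_size size_rem ?ends_hub // ends_size //; lia.
Qed.

(** Giving away one pebble of an odd pile breaks no pair on the hub; on the mate it completes a pair
    exactly when that pile is odd. *)
Lemma collapse_hub_succ en C (C' := swap_pebble C (hub en) (mate en)) :
  uniq (layer en) -> hub en \in layer en -> mate en \in layer en ->
  hub en != mate en -> odd (C (hub en)) ->
  \sum_(v <- layer en) (C' v)./2 = \sum_(v <- layer en) (C v)./2 + odd (C (mate en)).
Proof.
move=> uL hL mL nhm oh.
rewrite (big_rem (hub en)) // (big_rem (mate en)) /=; last first.
  by rewrite mem_rem_uniq // inE eq_sym nhm.
rewrite [in RHS](big_rem (hub en)) // [in RHS](big_rem (mate en)) /=; last first.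
  by rewrite mem_rem_uniq // inE eq_sym nhm.
have -> : (C' (hub en))./2 = (C (hub en))./2.
  by rewrite ffunE eqxx (negbTE nhm) addn0 subn1 half_pred_odd.
have -> : (C' (mate en))./2 = (C (mate en))./2 + odd (C (mate en)).
  by rewrite ffunE eqxx eq_sym (negbTE nhm) subn0 addn1 /= uphalf_half addnC.
suff -> : \sum_(v <- rem (mate en) (rem (hub en) (layer en))) (C' v)./2
        = \sum_(v <- rem (mate en) (rem (hub en) (layer en))) (C v)./2.
  by rewrite -!addnA; congr (_ + (_ + _)); rewrite addnC.
apply: eq_big_seq => v; rewrite mem_rem_uniq ?rem_uniq // inE => /andP[nvm].
rewrite mem_rem_uniq // inE => /andP[nvh _].
by rewrite ffunE (negbTE nvm) (negbTE nvh) subn0 addn0.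
Qed.

Lemma attached_weight lv en w : layered (adj G) r (en :: lv) ->
  weights_ok (en :: lv) w -> ~~ sealed lv -> w (up en) = 1.
Proof.
move=> [_ disj _ [ee att] lay] [_ wE _] ncl.
have [plv _] := attached_verts lay att.
have nph : up en != hub en.
  by apply: contraTneq plv => ->; apply/disj/ends_hub.
apply: wE => //.
  by move: plv; rewrite /verts /= !inE mem_cat => /orP[->|->]; rewrite ?orbT.
suff: up en \notin nodes r lv.
  by rewrite /nodes /=; case: ifP => //= _; rewrite !inE !negb_or nph.
move: att; rewrite /attached (negbTE ncl).
case: (lv) ncl lay => //= en0 lv0 ne [_ disj0 _ [ee0 _] lay0] /andP[/eqP-> _].
by rewrite /nodes /= (negbTE ne); apply/negP => /(nodes_verts lay0); apply/negP/disj0/ends_hub.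
Qed.

(** Below an unsealed level [up en] was empty, so an odd pile there after the collapse comes from a
    pair on the row. Odd piles in front of the first pair let the relay run. In the second
    alternative the mate may be empty and block it; then the hub lends its odd pebble to the
    mate. *)
Lemma swappable_collapse lv en C : layered (adj G) r (en :: lv) ->
  (~~ sealed lv -> C (up en) = 0) -> unsolvable C ->
  {in layer en, forall v, odd (C v)} \/
  [/\ hub en != mate en, unsolvable (swap_pebble C (hub en) (mate en)) &
      {in layer en, forall v, v != mate en -> odd (C v)}] ->
  swappable lv (collapse (layer en) (up en) C).
Proof.
move=> lay0 Cp nC odds; have [uL disj [aL pL] [ee att] lay] := lay0.
have pL' : up en \notin layer en.
  by apply/negP => /disj; have [-> _] := attached_verts lay att.
have nD : unsolvable (collapse (layer en) (up en) C).
  by move/(derives_solvable (derives_collapse C uL pL' aL)).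
have [cl|ncl] := boolP (sealed lv); first exact: swappable_sealed.
suff: odd (collapse (layer en) (up en) C (up en)) ->
    unsolvable (swap_pebble (collapse (layer en) (up en) C) (up en) (up' en)).
  move: att ncl; rewrite /attached; case: (lv) => //= en0 lv0 + ne.
  by rewrite (negbTE ne) => /andP[/eqP<- /eqP<-].
rewrite {1}ffunE (negbTE pL') eqxx Cp // add0n mul1n => /odd_gt0/heavy_split.
case=> s1 [u [s2 [eL Cu s1lt]]].
case: odds => [oL|[nhm nC' oL]].
  apply: (unsolvable_rim lay0 ncl eL) => // v vs; apply: oL.
  by rewrite eL mem_cat vs.
have [ms|ms] := boolP (mate en \in s1); last first.
  apply: (unsolvable_rim lay0 ncl eL) => // v vs; apply: oL.
    by rewrite eL mem_cat vs.
  by apply: contraNneq ms => <-.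
have [om|em] := boolP (odd (C (mate en))).
  apply: (unsolvable_rim lay0 ncl eL) => // v vs.
  by have [->//|nvm] := eqVneq v (mate en); apply: oL; rewrite // eL mem_cat vs.
have Cm : C (mate en) = 0 by have := s1lt _ ms; move: em; case: (C _) => [|[|]].
(* Hub and mate end the row, so a vertex behind the mate is the hub. *)
have eu : u = hub en.
  have uLs : u \in layer en by rewrite eL mem_cat inE eqxx orbT.
  move: uL; rewrite eL -cat_rcons cat_uniq rcons_uniq => /and3P[/andP[us1 _] /hasPn us2 _].
  have us2' : mate en \notin s2.
    by apply/negP => /us2; rewrite /= mem_rcons inE ms orbT.
  case: ee => s [[_ e]|[e _]|[e _]]; first by rewrite e eqxx in nhm.
    move: e; rewrite eL; case/lastP: s2 us2' {us2 eL} => [|s2 z].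
      rewrite -(cat1s (hub en)) catA !cats1 => _ /rcons_inj[_ eu].
      by move: us1; rewrite eu ms.
    rewrite -rcons_cons -rcons_cat -(cat1s (hub en)) catA cats1 => + /rcons_inj[_ ez].
    by rewrite ez mem_rcons inE eqxx.
  move: e; rewrite eL; case/lastP: s2 us2' {us2 eL} => [|s2 z].
    by rewrite -(cat1s (mate en)) catA !cats1 => _ /rcons_inj[].
  rewrite -rcons_cons -rcons_cat -(cat1s (mate en)) catA cats1.
  move=> + /rcons_inj[]; case/lastP: s2 => [|s2 z'].
    by rewrite !cats1 => _ /rcons_inj[_ eu]; move: us1; rewrite eu ms.
  rewrite -rcons_cons -rcons_cat cats1 => + /rcons_inj[_ ez].
  by rewrite ez mem_rcons inE mem_rcons inE eqxx orbT.
have hL := ends_hub ee; have mL := ends_mate ee.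
have oh : odd (C (hub en)) by apply: oL.
set C' := swap_pebble C (hub en) (mate en).
(* The hub is odd and the mate empty, so the loan changes no number of pairs and both configurations
   collapse alike. *)
have -> : collapse (layer en) (up en) C = collapse (layer en) (up en) C'.
  apply/ffunP => v; rewrite !ffunE collapse_hub_succ // (negbTE em) addn0.
  case: ifP => // /negbT vL.
  have nvh : v != hub en by apply: contraNneq vL => ->.
  have nvm : v != mate en by apply: contraNneq vL => ->.
  by rewrite (negbTE nvh) (negbTE nvm) subn0 addn0.
apply: (unsolvable_rim lay0 ncl eL) => // [v vs|].
  rewrite ffunE; have [->|nvm] := eqVneq v (mate en).
    by rewrite Cm eq_sym (negbTE nhm).
  have nvh : v != hub en.
    apply: contraTneq vs => ->; rewrite -eu.
    by move: uL; rewrite eL cat_uniq /= => /and3P[_ /norP[]].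
  by rewrite (negbTE nvh) subn0 addn0 oL // eL mem_cat vs.
(* An odd pile of at least 2 has at least 3 pebbles, so a pair remains on the hub after the loan. *)
rewrite ffunE eu eqxx (negbTE nhm) addn0 subn1.
by move: oh; rewrite -eu; move: Cu; case: (C u) => [|[|[|]]].
Qed.

(** A collapse that wastes weight pays for the defect at once. One that wastes nothing leaves a
    swappable configuration, to which the sharp bound applies. So the defect does not accumulate,
    although every level with a mate adds 1. *)
Lemma weight_bound lv w C :
  layered (adj G) r lv -> weights_ok lv w ->
  (forall v, v \notin verts r lv -> C v = 0) -> unsolvable C -> 0 < t ->
  \sum_v w v * C v <= cost t r lv w + total_excess lv + 1 /\
  (swappable lv C -> \sum_v w v * C v <= cost t r lv w + total_excess lv).
Proof.
move=> + + + + t0; elim: lv w C => [|en lv IH] w C.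
  move=> _ _ C0 nC; suff le : \sum_v w v * C v <= w r * t.-1.
    by rewrite /= /total_excess big_nil addn0; split=> // ; rewrite addn1 leqW.
  rewrite (bigD1 r) //= big1 ?addn0 => [|v nvr].
    rewrite leq_mul2l; apply/orP; right; rewrite -ltnS prednK // ltnNge.
    by apply/negP => tC; apply: nC; exists [::].
  by rewrite C0 ?muln0 // inE.
move=> lay0 wok C0 nC.
have [uL disj [aL pL] [ee att] lay] := lay0.
have wok' := reweight_ok lay0 wok; have sumw := hub_weights lay0 wok.
have [w1 wE w2] := wok; set p := up en; set L := layer en.
set w' := reweight w en; pose D := collapse L p C.
have [plv p'lv] := attached_verts lay att.
have pL' : p \notin L by apply/negP => /disj; rewrite plv.
have nD : ~ solvable G t r D.
  by move/(derives_solvable (derives_collapse C uL pL' aL)).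
have out v : v \notin verts r lv -> v \notin L -> C v = 0.
  move=> + vL; rewrite inE negb_or => /andP[nvr vlv]; apply: C0.
  by rewrite /verts /= inE mem_cat !negb_or nvr vL.
have D0 v : v \notin verts r lv -> D v = 0.
  move=> vlv; rewrite ffunE; case: ifP => // /negbT vL; rewrite out //.
  by case: eqP vlv => [->|//]; rewrite plv.
have [IH1 IH2] := IH w' D lay wok' D0 nD.
have w'p : w' p = maxn (w p) (2 * w (hub en)) by rewrite /w' /reweight eqxx.
have wL v : v \in L -> 2 * w v <= w' p.
  move=> vL; rewrite w'p leq_max; apply/orP; right; rewrite leq_mul2l /=.
  have [->//|nvh] := eqVneq v (hub en).
  have vn : v \notin nodes r lv by apply/negP => /(nodes_verts lay); apply/negP/disj.
  rewrite wE //; first by rewrite /verts /= inE mem_cat vL orbT.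
  move: vn; rewrite /nodes /=; case: ifP => //= _.
  by rewrite !inE !negb_or nvh.
have w'E v : v != p -> w' v = w v by rewrite /w' /reweight => /negbTE->.
have wp : w p <= w' p by rewrite w'p leq_maxl.
have := weight_collapse C uL pL' w'E wp wL; rewrite -/D => bound.
move: bound; rewrite sumw /=.
set S := \sum_v w v * C v; set S1 := \sum_v w' v * D v.
set s1 := \sum_(v <- L) w v * ~~ odd (C v); set s2 := (w' p - w p) * C p => bound.
rewrite /total_excess big_cons -/(total_excess lv) -/w'.
have IH' D' := IH w' D' lay wok'.
move: (cost t r lv w') (total_excess lv) (excess en) => c T x in IH1 IH2 IH' bound *.
(* The hub above an unsealed level rises from weight 1 to at least 2, so any pebble on it is
   waste. *)
have Cp0 : s2 = 0 -> ~~ sealed lv -> C p = 0.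
  rewrite /s2 w'p => s20 ncl; have := attached_weight lay0 wok ncl.
  rewrite -/p => wp1; move: s20; rewrite wp1 => /eqP; rewrite muln_eq0 subn_eq0.
  rewrite geq_max leqnn /= leqNgt => /orP[/negP[]|/eqP//].
  by have := w1 (hub en); clear; lia.
have all_odd : s1 = 0 -> {in L, forall v, odd (C v)}.
  move/eqP; rewrite sum_nat_seq_eq0 => /allP s10 v /s10.
  by rewrite muln_eq0 -[w v == 0]negbK -lt0n w1 /=; case: odd.
have key : s1 + s2 = 0 -> swappable lv D.
  move/eqP; rewrite addn_eq0 => /andP[/eqP s10 /eqP s20].
  by apply: swappable_collapse => //; [apply: Cp0 | left; apply: all_odd].
(* Positive waste absorbs the defect of the coarse bound; without waste the sharp bound is
   available. *)
have S1le : S1 <= c + T + s1 + s2.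
  by have [/key/IH2|pos] := posnP (s1 + s2); [clear; lia|clear -pos IH1; lia].
have [ehm|nhm] := eqVneq (hub en) (mate en).
  by move: bound; rewrite ehm eqxx /= => bound; split=> [|_]; clear -bound S1le; lia.
move: bound; rewrite nhm /= => bound; split=> [|sw].
  by clear -bound S1le; lia.
have wh2 := w2 nhm.
have hL := ends_hub ee; have mL := ends_mate ee.
(* An even hub wastes its own weight, which is at least 2: one unit for the mate and one for the
   defect of the coarse bound. *)
have [oh|eh] := boolP (odd (C (hub en))); last first.
  suff: w (hub en) <= s1 by clear -bound IH1 wh2; lia.
  by rewrite /s1 (big_rem (hub en)) //= eh muln1 leq_addr.
have {sw} nC' := sw oh; set C' := swap_pebble C (hub en) (mate en) in nC'.
(* If hub and mate are odd, the swapped configuration collapses to [D] with one more pebble on [p]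
   and is still unsolvable. The coarse bound for it leaves [D] a margin of [w' p], at least 4. *)
have [om|em] := boolP (odd (C (mate en))).
  pose D' := collapse L p C'.
  have nD' : ~ solvable G t r D'.
    by move/(derives_solvable (derives_collapse C' uL pL' aL)).
  have D'E v : D' v = D v + (v == p).
    rewrite !ffunE collapse_hub_succ // om; case: ifP => [vL|/negbT vL].
      by case: eqP vL pL' => // -> ->.
    have nvh : v != hub en by apply: contraNneq vL => ->.
    have nvm : v != mate en by apply: contraNneq vL => ->.
    by rewrite (negbTE nvh) (negbTE nvm) subn0 addn0 mulnDr muln1 addnA.
  have [|+ _] := IH' D' _ nD'.
    move=> v vlv; rewrite D'E D0 //.
    by case: eqP vlv => // ->; rewrite plv.
  have -> : \sum_v w' v * D' v = S1 + w' p.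
    rewrite (eq_bigr (fun v => w' v * D v + w' v * (v == p))) => [|v _].
      rewrite big_split /=; congr (_ + _); rewrite (bigD1 p) //= eqxx muln1.
      by rewrite big1 ?addn0 // => v /negbTE->; rewrite muln0.
    by rewrite D'E mulnDr.
  by have := wL _ hL; clear -bound wh2; lia.
have s1m : s1 = w (mate en) + \sum_(v <- rem (mate en) L) w v * ~~ odd (C v).
  by rewrite /s1 (big_rem (mate en)) //= em muln1.
(* An even mate wastes at least 1. Either the waste reaches 2, or the mate is the only even pile and
   the sharp bound holds for [D]. *)
have [ge2|lt2] := leqP 2 (s1 + s2); first by clear -bound IH1 ge2; lia.
have := w1 (mate en) => wm.
have [s20 rest0] : s2 = 0 /\ \sum_(v <- rem (mate en) L) w v * ~~ odd (C v) = 0.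
  by clear -lt2 s1m wm; lia.
suff /IH2 : swappable lv D by clear -bound s1m wm; lia.
apply: swappable_collapse => //; first exact: Cp0.
right; split=> // v vL nvm; move/eqP: rest0; rewrite sum_nat_seq_eq0 => /allP/(_ v).
rewrite mem_rem_uniq // inE nvm vL => /(_ isT).
by rewrite muln_eq0 -[w v == 0]negbK -lt0n w1 /=; case: odd.
Qed.

End UpperBound.

(** * The lower bound *)

Section LowerBound.
Variables (V : finType) (r : V).
Implicit Types (en : level V) (lv : seq (level V)) (u v x z : V) (w : V -> nat).

Definition level_edge en : rel V := fun u v =>
  (u \in layer en) && [|| v \in layer en, v == up en | v == up' en].

Definition covers lv (e : rel V) : Prop :=
  forall u v, e u v -> has (fun en => level_edge en u v || level_edge en v u) lv.

Fixpoint group lv v : V :=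
  if lv is en :: lv' then if v == mate en then hub en else group lv' v else v.

Fixpoint parent lv v : V :=
  if lv is en :: lv' then if v \in layer en then up en else parent lv' v else v.

Lemma verts_cons lv en v :
  (v \in verts r (en :: lv)) = (v \in layer en) || (v \in verts r lv).
Proof. by rewrite /verts /= !inE mem_cat orbCA. Qed.

Lemma group_out e lv v : layered e r lv -> v \notin verts r lv -> group lv v = v.
Proof.
elim: lv => //= en lv IH [_ _ _ [ee _] lay]; rewrite verts_cons negb_or => /andP[vL vlv].
by case: eqP vL => [->|_ _]; [rewrite ends_mate | apply: IH].
Qed.

Lemma group_verts e lv v : layered e r lv -> v \in verts r lv -> group lv v \in verts r lv.
Proof.
elim: lv v => //= en lv IH v [_ _ _ [ee _] lay]; rewrite !verts_cons.
case: eqP => [_ _|_]; first by rewrite ends_hub.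
have [vlv _|vlv] := boolP (v \in verts r lv); first by rewrite IH ?orbT.
by rewrite (group_out lay vlv) orbF => ->.
Qed.

Lemma group_row e lv en v : layered e r (en :: lv) -> v \in layer en ->
  group (en :: lv) v = if v == mate en then hub en else v.
Proof.
by move=> [_ disj _ _ lay] /disj vL /=; rewrite (group_out lay vL).
Qed.

Lemma group_old e lv en v : layered e r (en :: lv) -> v \in verts r lv ->
  group (en :: lv) v = group lv v.
Proof.
move=> [_ disj _ [ee _] _] vlv /=; case: eqP => // ve.
by have := disj _ (ends_mate ee); rewrite -ve vlv.
Qed.

Lemma parent_old e lv en v : layered e r (en :: lv) -> v \in verts r lv ->
  parent (en :: lv) v = parent lv v.
Proof. by move=> [_ disj _ _ _] vlv /=; case: ifP => // /disj; rewrite vlv. Qed.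

Lemma group_node e lv v : layered e r lv -> v \in nodes r lv -> group lv v = v.
Proof.
elim: lv => //= en lv IH lay0; have [_ disj _ [ee _] lay] := lay0.
have old : v \in nodes r lv -> group (en :: lv) v = v.
  by move=> vn; rewrite (group_old lay0) ?IH //; apply: nodes_verts lay _ vn.
rewrite /nodes /=; case: ifP => [/eqP he|_ //]; rewrite !inE orbCA => /orP[/eqP->|//].
by rewrite he eqxx.
Qed.

Lemma group_up e lv en : layered e r (en :: lv) ->
  group (en :: lv) (up en) = up en /\ group (en :: lv) (up' en) = up en.
Proof.
move=> lay0; have [_ disj _ [ee att] lay] := lay0.
have [upv upv'] := attached_verts lay att.
rewrite !(group_old lay0) //.
move: att; rewrite /attached; case: ifP => [_ /andP[/eqP<- upn]|].
  by rewrite (group_node lay upn).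
case: (lv) lay => //= en0 lv0 [_ disj0 _ [ee0 _] lay0'] ne /andP[/eqP-> /eqP->].
by rewrite eqxx ne (group_out lay0') // disj0 ?ends_hub.
Qed.

Lemma level_edge_verts e lv u v : layered e r lv ->
  has (fun en => level_edge en u v || level_edge en v u) lv ->
  u \in verts r lv /\ v \in verts r lv.
Proof.
elim: lv => //= en lv IH [_ _ _ [_ att] lay]; have [upv upv'] := attached_verts lay att.
rewrite !verts_cons => /orP[|/(IH lay)[-> ->]]; last by rewrite !orbT.
by case/orP=> /andP[-> /or3P[->|/eqP->|/eqP->]]; rewrite ?upv ?upv' ?orbT.
Qed.

(** The image of an edge in the merged tree. Edges inside a row may join siblings, which are not
    adjacent in the tree but gain nothing: two pebbles leaving [a] cost the parent one, and the
    pebble reaching [b] returns at most one. *)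
Variant group_edge lv (a b : V) : Prop :=
| SameGroup of a = b
| ToParent of a != r & parent lv a = b
| ToChild of b != r & parent lv b = a
| ToSibling of a != r & b != r & parent lv a = parent lv b.

Lemma group_edge_sym lv a b : group_edge lv a b -> group_edge lv b a.
Proof.
case=> [->|ar pa|br pb|ar br e]; first exact: SameGroup.
- exact: ToChild.
- exact: ToParent.
- exact: ToSibling.
Qed.

Lemma group_level_edge e lv en u v : layered e r (en :: lv) -> level_edge en u v ->
  group_edge (en :: lv) (group (en :: lv) u) (group (en :: lv) v).
Proof.
move=> lay0; have [_ disj _ [ee att] lay] := lay0; have [gu gu'] := group_up lay0.
have inL z : z \in layer en -> group (en :: lv) z \in layer en.
  by move=> zL; rewrite (group_row lay0 zL); case: ifP => // _; apply: ends_hub.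
have nr z : z \in layer en -> group (en :: lv) z != r.
  move/inL => gL; apply/eqP => gr; have := disj _ gL.
  by rewrite gr inE eqxx.
have pL z : z \in layer en -> parent (en :: lv) (group (en :: lv) z) = up en.
  by move/inL => gL /=; rewrite /= in gL; rewrite gL.
case/andP=> uL /or3P[vL|/eqP->|/eqP->].
- by apply: ToSibling; rewrite ?nr // !pL.
- by apply: ToParent; rewrite ?nr // pL ?gu.
- by apply: ToParent; rewrite ?nr // pL ?gu'.
Qed.

Lemma covers_group_edge e lv u v : layered e r lv ->
  has (fun en => level_edge en u v || level_edge en v u) lv ->
  group_edge lv (group lv u) (group lv v).
Proof.
elim: lv => // en lv IH lay0; have lay : layered e r lv by case: lay0.
case/orP=> [/orP[|]|uv].
- exact: group_level_edge lay0.
- by move/(group_level_edge lay0)/group_edge_sym.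
have [ulv vlv] := level_edge_verts lay uv.
rewrite !(group_old lay0) //; have := IH lay uv.
have [ugv vgv] := (group_verts lay ulv, group_verts lay vlv).
case=> [->|ar pa|br pb|ar br ee]; first exact: SameGroup.
- by apply: ToParent; rewrite ?(parent_old lay0).
- by apply: ToChild; rewrite ?(parent_old lay0).
- by apply: ToSibling; rewrite ?(parent_old lay0).
Qed.

Lemma parent_out lv v : v \notin verts r lv -> parent lv v = v.
Proof.
elim: lv => //= en lv IH; rewrite verts_cons negb_or => /andP[/negbTE-> ?].
exact: IH.
Qed.

Lemma parent_verts e lv v : layered e r lv -> v \in verts r lv -> v != r ->
  parent lv v \in verts r lv.
Proof.
elim: lv => [_|en lv IH] /=; first by rewrite inE => ->.
case=> _ _ _ [_ att] lay; have [upv _] := attached_verts lay att.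
rewrite !verts_cons; case: ifP => [_ _ _|_ /= vlv vr]; first by rewrite upv orbT.
by rewrite IH ?orbT.
Qed.

(* [A] bounds, for each group of vertices, the number of pebbles that can be
   brought to it from its descendants. *)
Definition potential lv (C : config V) (A : V -> nat) : Prop :=
  forall x, \sum_(v | group lv v == x) C v
            + \sum_(z | (z != r) && (parent lv z == x)) (A z)./2 <= A x.

(** Removing two pebbles lowers a half by exactly one, and adding one raises it by at most one. The
    flags [da] and [db] tell which end of the move has its value changed. *)
Lemma potential_move lv (A A' : V -> nat) a b (da db : bool) x :
  (da -> a != r /\ 2 <= A a) -> (db -> b != r) -> a != b ->
  (forall z, A' z = A z - 2 * (da && (z == a)) + (db && (z == b))) ->
  \sum_(z | (z != r) && (parent lv z == x)) (A' z)./2 + (da && (parent lv a == x))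
  <= \sum_(z | (z != r) && (parent lv z == x)) (A z)./2 + (db && (parent lv b == x)).
Proof.
move=> ha hb nab A'E.
have single (d : bool) c : (d -> c != r) ->
    \sum_(z | (z != r) && (parent lv z == x)) (d && (z == c) : nat)
    = (d && (parent lv c == x)).
  case: d => [cr|_]; last by rewrite big1.
  have [pc|pc] := boolP (parent lv c == x).
    rewrite (bigD1 c) /= ?cr // eqxx big1 ?addn0 // => z.
    by case/andP=> _ /negbTE->.
  by rewrite big1 // => z /andP[_ pz]; case: eqP => // ze; rewrite -ze pz in pc.
rewrite -[in X in X <= _]single => [|/ha[]//]; rewrite -[in X in _ <= X]single //.
rewrite -!big_split /=; apply: leq_sum => z _; rewrite {}A'E.
have half_addb n (d : bool) : (n + d)./2 <= n./2 + d.
  by case: d; rewrite ?addn0 // !addn1 /= uphalf_half -add1n leq_add2r leq_b1.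
case: da ha => /= [/(_ isT)[_ Aa]|_]; last by rewrite muln0 subn0 addn0 half_addb.
have [->|_] := eqVneq z a; last by rewrite muln0 subn0 addn0 half_addb.
rewrite (negbTE nab) andbF !addn0 muln1 addn1.
by case: (A a) Aa => [|[|k]] // _; rewrite subn2.
Qed.

(** A move to the parent delivers a pebble already counted there, a move to a child can return at
    most one of the two pebbles spent, and a move to a sibling does not enrich the parent. Hence the
    value at the root can be kept. *)
Lemma potential_step (G : sgraph V) lv C C' A :
  layered (adj G) r lv -> covers lv (adj G) -> potential lv C A ->
  pebble_step G C C' -> exists2 A', potential lv C' A' & A' r = A r.
Proof.
move=> lay cov pot /existsP[u /existsP[v /and3P[uv Cu /eqP C'E]]].
set a := group lv u; set b := group lv v.
have sumC' x : \sum_(w | group lv w == x) C' w + 2 * (a == x)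
             = \sum_(w | group lv w == x) C w + (b == x).
  have single c : \sum_(w | group lv w == x) (w == c : nat) = (group lv c == x).
    have [gc|gc] := boolP (group lv c == x).
      by rewrite (bigD1 c) //= eqxx big1 ?addn0 // => w /andP[_ /negbTE->].
    by rewrite big1 // => w gw; case: eqP => // we; rewrite -we gw in gc.
  rewrite /a /b -!single big_distrr /= -!big_split /=; apply: eq_bigr => w _.
  rewrite C'E ffunE addnAC; congr (_ + _); rewrite subnK //.
  by case: eqP => [->|_]; rewrite ?muln1 ?muln0.
have Aa : 2 <= A a.
  apply: leq_trans (pot a); apply: leq_trans (leq_addr _ _).
  by rewrite (bigD1 u) //= (leq_trans Cu) ?leq_addr.
have main (da db : bool) : a != b -> (da -> a != r) -> (db -> b != r) ->
    (forall x, 2 * da * (a == x) + (b == x) + (db && (parent lv b == x))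
               <= 2 * (a == x) + (da && (parent lv a == x)) + (db && (b == x))) ->
    exists2 A', potential lv C' A' & A' r = A r.
  move=> nab ar br le.
  exists (fun z => A z - 2 * (da && (z == a)) + (db && (z == b))); last first.
    have -> : da && (r == a) = false.
      by case: da ar {le} => // /(_ isT); rewrite eq_sym => /negbTE.
    have -> : db && (r == b) = false.
      by case: db br {le} => // /(_ isT); rewrite eq_sym => /negbTE.
    by rewrite muln0 subn0 addn0.
  move=> x; have ha : da -> a != r /\ 2 <= A a by move/ar.
  have := @potential_move lv A _ a b da db x ha br nab (fun z => erefl).
  set H' := \sum_(z | _) _; set H := \sum_(z | _) _ => leH.
  have := pot x; have := sumC' x; rewrite -/H.
  move: (\sum_(w | _) C' w) (\sum_(w | _) C w) => S' S eS leS.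
  have := le x; rewrite [x == a]eq_sym [x == b]eq_sym.
  have Ax : 2 * (da && (a == x)) <= A x.
    by case: da {ar ha le leH H'} => //; case: eqP => //= <-; rewrite muln1.
  move: eS leS leH Ax; move: (A x) H' H => Ax H' H; clear.
  move: (parent lv a == x) (parent lv b == x) (a == x) (b == x) => b1 b2 b3 b4.
  by case: da; case: b3; rewrite /= ?muln0 ?muln1 ?mul1n ?mul0n => *; lia.
have := covers_group_edge lay (cov _ _ uv); rewrite -/a -/b.
have [eab _|nab] := eqVneq a b.
  exists A => // x; apply: leq_trans (pot x); rewrite leq_add2r.
  have := sumC' x; rewrite eab; move: (\sum_(w | _) C' w) => S'.
  by move: (\sum_(w | _) C w) => S; clear; case: (b == x) => /=; lia.
case=> [ab|ar pa|br pb|ar br e]; first by rewrite ab eqxx in nab.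
- by apply: (main true false) => //= x; rewrite pa; clear; lia.
- by apply: (main false true) => //= x; rewrite pb; clear; lia.
- by apply: (main true true) => //= x; rewrite e; clear; lia.
Qed.

Lemma unsolvable_potential (G : sgraph V) lv C A t :
  layered (adj G) r lv -> covers lv (adj G) -> potential lv C A -> A r < t ->
  ~ solvable G t r C.
Proof.
move=> lay cov + + [Cs]; elim: Cs C A => [|C' Cs IH] C A pot ltA /=.
  move=> _ leC; have := pot r; apply/negP; rewrite -ltnNge.
  apply: leq_trans ltA _; apply: leq_trans leC _; apply: leq_trans (leq_addr _ _).
  have gr : group lv r = r by apply: group_node lay _; rewrite inE eqxx.
  by rewrite (bigD1 r) ?gr //= leq_addr.
case/andP=> st pCs; have [A' pot' A'r] := potential_step lay cov pot st.
by apply: (IH C' A') pCs => //; rewrite A'r.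
Qed.

(** The extremal configuration, obtained by undoing the trades of [reweight] from the root
    downwards. Each vertex that is neither hub nor mate gets one pebble, which halving discards; the
    mate gets none, being merged with the hub. *)
Lemma heavy_config e lv t w : layered e r lv -> (forall v, 0 < w v) ->
  exists (C : config V) (A : V -> nat),
    [/\ forall v, v \notin verts r lv -> C v = 0, potential lv C A,
        A r = t.-1 & cost t r lv w + total_excess lv <= \sum_v w v * C v].
Proof.
elim: lv w => [|en lv IH] w.
  move=> _ _; exists [ffun v => t.-1 * (v == r)], (fun v => t.-1 * (v == r)).
  rewrite eqxx muln1; split=> //.
  - by move=> v; rewrite inE ffunE => /negbTE->; rewrite muln0.
  - move=> x; rewrite /= big_pred1_eq ffunE big1 ?addn0 // => z.
    by case/andP=> /negbTE->; rewrite muln0.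
  - rewrite /= /total_excess big_nil addn0 (bigD1 r) //= ffunE eqxx muln1.
    exact: leq_addr.
move=> lay0 w1; have [uL disj _ [ee att] lay] := lay0.
have w'1 v : 0 < reweight w en v.
  by rewrite /reweight; case: ifP => _; rewrite ?leq_max w1.
have [C [A [C0 pot Ar big]]] := IH _ lay w'1.
have [upv _] := attached_verts lay att.
have upL : up en \notin layer en by apply/negP => /disj; rewrite upv.
(* The pebbles of [up en] move down, doubled, exactly when they weigh more on the hub. From
   [2 * c + 1] pebbles there, [c] can return, so [A] stays valid on the older vertices. *)
pose c := if 2 * w (hub en) <= w (up en) then 0 else C (up en).
pose B v := if v == hub en then 2 * c + 1 else (v != mate en : nat).
pose C' : config V := [ffun v => if v \in layer en then B v else C v - c * (v == up en)].
exists C', (fun v => if v \in layer en then B v else A v); split.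
- move=> v; rewrite verts_cons negb_or ffunE => /andP[/negbTE-> vlv].
  by rewrite C0.
- move=> x; have [xL|xL] := boolP (x \in layer en).
    rewrite [X in _ + X]big1 ?addn0 => [|z /andP[zr] /=].
      have [->|nxh] := eqVneq x (hub en).
        have hg : group (en :: lv) (hub en) = hub en.
          by rewrite (group_row lay0) ?ends_hub //; case: ifP.
        rewrite (bigD1 (hub en)) ?hg //= ffunE ends_hub // /B eqxx.
        rewrite big1 ?addn0 // => v /andP[/eqP gv nvh].
        have [vL|vL] := boolP (v \in layer en).
          rewrite ffunE vL /B (negbTE nvh); case: eqP gv => // nvm.
          by move: nvh; rewrite (group_out lay (disj _ vL)) => + ve; rewrite ve eqxx.
        have [vlv|vlv] := boolP (v \in verts r lv).
          move: gv; case: eqP => [ve|_ gv]; first by rewrite ve ends_mate in vL.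
          by have := disj _ (ends_hub ee); rewrite -gv (group_verts lay vlv).
        by rewrite ffunE (negbTE vL) C0.
      have [xm|nxm] := eqVneq x (mate en).
        rewrite big1 // => v; rewrite -/(group (en :: lv) v) => /eqP gv.
        have [vL|vL] := boolP (v \in layer en).
          move: gv; rewrite (group_row lay0) //; case: eqP => [_ hx|nvm vx].
            by rewrite hx eqxx in nxh.
          by rewrite vx xm in nvm.
        have [vlv|vlv] := boolP (v \in verts r lv).
          move: gv; rewrite (group_old lay0) // => gv.
          by have := disj _ xL; rewrite -gv (group_verts lay vlv).
        by rewrite ffunE (negbTE vL) C0.
      have gx : group (en :: lv) x = x by rewrite (group_row lay0) // (negbTE nxm).
      rewrite (bigD1 x) ?gx //= ffunE xL big1 ?addn0 // => v /andP[/eqP gv nvx].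
      have [vL|vL] := boolP (v \in layer en).
        move: gv; rewrite -/(group (en :: lv) v) (group_row lay0) //.
        case: eqP => [_ hx|_ vx]; first by rewrite hx eqxx in nxh.
        by rewrite vx eqxx in nvx.
      have [vlv|vlv] := boolP (v \in verts r lv).
        move: gv; rewrite -/(group (en :: lv) v) (group_old lay0) // => gv.
        by have := disj _ xL; rewrite -gv (group_verts lay vlv).
      by rewrite ffunE (negbTE vL) C0.
    case: ifP => [zL /eqP ux|zL /eqP px]; first by rewrite -ux (negbTE upL) in xL.
    have [zlv|zlv] := boolP (z \in verts r lv).
      by have := disj _ xL; rewrite -px (parent_verts lay).
    by move: xL; rewrite -px parent_out // zL.
  have old_group f : \sum_(v | group (en :: lv) v == x) f v
      = \sum_(v | (group lv v == x) && (v \notin layer en)) f v :> nat.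
    apply: eq_bigl => v; have [vL|vL] := boolP (v \in layer en).
      rewrite andbF; apply/eqP => gv; have := group_row lay0 vL; rewrite gv.
      by case: ifP => _ ex; rewrite ex ?ends_hub ?vL in xL.
    by rewrite /= andbT; case: (v =P mate en) => // ve; rewrite ve ends_mate in vL.
  have cC v : c * (v == up en) <= C v.
    by rewrite /c; case: eqP => [->|_]; rewrite ?muln0 // muln1; case: ifP.
  have newC : \sum_(v | (group lv v == x) && (v \notin layer en)) C' v + c * (x == up en)
      = \sum_(v | (group lv v == x) && (v \notin layer en)) C v.
    have gu : group lv (up en) = up en.
      by rewrite -(group_old lay0 upv); case: (group_up lay0).
    have -> : c * (x == up en)
        = \sum_(v | (group lv v == x) && (v \notin layer en)) c * (v == up en).
      have [->|nxu] := eqVneq x (up en).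
        rewrite (bigD1 (up en)) ?gu ?eqxx //= big1 ?addn0 // => v.
        by case/andP=> _ /negbTE->; rewrite muln0.
      rewrite muln0 big1 // => v /andP[/eqP gv _]; case: eqP => [ve|]; rewrite ?muln0 //.
      by move: nxu; rewrite -gv ve gu eqxx.
    rewrite -big_split; apply: eq_bigr => v /andP[_ /negbTE vL] /=.
    by rewrite ffunE vL subnK.
  have newA : \sum_(z | (z != r) && (parent (en :: lv) z == x))
                 (if z \in layer en then B z else A z)./2
      <= c * (x == up en) + \sum_(z | (z != r) && (parent lv z == x)) (A z)./2.
    rewrite (bigID (mem (layer en))) /=; apply: leq_add.
      have [->|nxu] := eqVneq x (up en); last first.
        rewrite big1 // => z /andP[/andP[_ +] zL].
        by rewrite zL => /eqP ux; rewrite -ux eqxx in nxu.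
      rewrite muln1 big_mkcond (bigD1 (hub en)) //= big1 ?addn0 => [|z nzh].
        case: ifP => // _; rewrite ends_hub // /B eqxx addn1 /= mul2n.
        by rewrite uphalf_double.
      case: ifP => // /andP[_ zL]; rewrite zL /B (negbTE nzh).
      by case: (_ != _).
    rewrite [X in _ <= X](bigID (mem (layer en))) /=; apply: leq_trans (leq_addl _ _).
    rewrite big_mkcond [X in _ <= X]big_mkcond; apply: leq_sum => z _.
    by case: (z \in layer en); rewrite ?andbF // !andbT.
  have oldC : \sum_(v | (group lv v == x) && (v \notin layer en)) C v
      <= \sum_(v | group lv v == x) C v.
    by rewrite [X in _ <= X](bigID (mem (layer en))) /= leq_addl.
  rewrite old_group; apply: leq_trans (leq_add (leqnn _) newA) _.
  by rewrite addnA newC (leq_trans _ (pot x)) // leq_add2r.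
- by case: ifP => // rL; have := disj _ rL; rewrite inE eqxx.
- rewrite /= /total_excess big_cons -/(total_excess lv).
  have rowC : w (hub en) * (2 * c + 1) + excess en <= \sum_(v in layer en) w v * C' v.
    rewrite -big_uniq //= (big_rem (hub en)) ?ends_hub //= ffunE ends_hub //.
    rewrite {1}/B eqxx leq_add2l.
    have -> : excess en = \sum_(v <- rem (hub en) (layer en)) (v != mate en : nat).
      have [ehm|nhm] := eqVneq (hub en) (mate en).
        rewrite -ehm big_seq (eq_bigr (fun=> 1)) => [|v]; last first.
          by rewrite mem_rem_uniq // inE => /andP[->].
        rewrite -big_seq sum1_size size_rem ?ends_hub // /excess ehm eqxx.
        by rewrite subn1.
      rewrite (big_rem (mate en)) /= ?eqxx; last first.
        by rewrite mem_rem_uniq // inE eq_sym nhm ends_mate.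
      rewrite big_seq (eq_bigr (fun=> 1)) => [|v]; last first.
        by rewrite mem_rem_uniq ?rem_uniq // inE => /andP[->].
      rewrite -big_seq sum1_size !size_rem ?ends_hub //; last first.
        by rewrite mem_rem_uniq // inE eq_sym nhm ends_mate.
      by rewrite /excess nhm; case: (size _) => [|[|k]]; rewrite // subn2.
    rewrite big_seq [X in _ <= X]big_seq; apply: leq_sum => v.
    rewrite mem_rem_uniq // inE => /andP[nvh vL].
    by rewrite ffunE vL /B (negbTE nvh) leq_pmull.
  have restC : \sum_v reweight w en v * C v
      <= \sum_(v | v \notin layer en) w v * C' v + 2 * (w (hub en) * c).
    rewrite (bigID (mem (layer en))) /= big1 ?add0n => [|v vL]; last first.
      by rewrite C0 ?muln0 // disj.
    rewrite (bigD1 (up en)) // [X in _ <= X + _](bigD1 (up en)) //=.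
    rewrite ffunE (negbTE upL) eqxx muln1 /reweight eqxx.
    have -> : \sum_(v | (v \notin layer en) && (v != up en)) w v * C' v
       = \sum_(v | (v \notin layer en) && (v != up en))
           (if v == up en then maxn (w v) (2 * w (hub en)) else w v) * C v.
      apply: eq_bigr => v /andP[/negbTE vL /negbTE nvu].
      by rewrite ffunE vL nvu muln0 subn0.
    rewrite addnAC leq_add2r /c; case: (leqP (2 * w (hub en)) (w (up en))) => [le|lt].
      by rewrite subn0 !muln0 addn0.
    by rewrite subnn muln0 add0n mulnA.
  rewrite [X in _ <= X](bigID (mem (layer en))) /=.
  move: rowC restC big; rewrite mulnDr muln1 mulnCA.
  move: (\sum_(v in layer en) _) => x; move: (\sum_(v | v \notin layer en) _) => y.
  move: (\sum_v _) (total_excess lv) (excess en) (w (hub en)) => z s d h.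
  by move: (cost _ _ _ _) (_ * _) => k l; clear; lia.
Qed.

(** With all weights 1 the weighted size is the size. As the list is sealed, every unsolvable
    configuration is swappable, so only the sharp bound is used, and it meets the extremal
    configuration. *)
Theorem pebbling_number_layered (G : sgraph V) lv t :
  layered (adj G) r lv -> sealed lv -> covers lv (adj G) ->
  vset G =i verts r lv -> 0 < t ->
  pebbling_number G t r = (cost t r lv (fun=> 1) + total_excess lv).+1.
Proof.
move=> lay cl cov vG t0; set m := cost _ _ _ _ + _.
have wok : weights_ok r lv (fun=> 1).
  by split=> //; case: lv cl {lay cov vG m} => //= en lv ->.
have size1 C : csize C = \sum_v 1 * C v by apply: eq_bigr => v _; rewrite mul1n.
have upper : solvable_from G t r m.+1.
  move=> C /forallP onG big; apply: contrapT => nC.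
  have C0 v : v \notin verts r lv -> C v = 0.
    by rewrite -vG => vlv; have := onG v; rewrite (negbTE vlv) implybF negbK => /eqP.
  have [_ /(_ (swappable_sealed cl nC))] := weight_bound lay wok C0 nC t0.
  by rewrite -size1; apply/negP; rewrite -ltnNge.
have lower s : solvable_from G t r s -> m < s.
  have [C [A [C0 pot Ar]]] := heavy_config t lay (fun=> isT : 0 < 1).
  rewrite -size1 => big; rewrite ltnNge => sol; apply/negP => sm.
  apply: (unsolvable_potential lay cov pot (t := t)); first by rewrite Ar prednK.
  apply: sol; last exact: leq_trans sm big.
  by apply/forallP => v; apply/implyP; rewrite vG; apply: contraR => /C0->.
rewrite /pebbling_number; case: pselect => [exs|[]]; last first.
  by exists m.+1; apply/asboolP.
case: ex_minnP => k /asboolP solk mink; apply/eqP; rewrite eqn_leq lower // andbT.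
by apply: mink; apply/asboolP.
Qed.

End LowerBound.

(** * 2-trees *)

Section TwoTrees.
Variable V : finType.
Implicit Types (G H : sgraph V) (u v x y z g b : V).

Lemma sgraph_eq G H : vset G = vset H -> eset G = eset H -> G = H.
Proof.
case: G => -[A E] wA; case: H => -[B F] wB; rewrite /vset /eset /= => eA eE.
by apply: val_inj; rewrite /= eA eE.
Qed.

Lemma eset_adj G e : e \in eset G -> exists u v, e = [set u; v] /\ adj G u v.
Proof.
move=> eG; have : #|e| == 2.
  by case: G eG => -[A E] /= wf; rewrite /eset /= => /(forall_inP wf)/andP[].
by case/cards2P=> u [v [_ ee]]; exists u, v; rewrite /adj -ee.
Qed.

Lemma sgraph_adj_eq G H : vset G =i vset H -> adj G =2 adj H -> G = H.
Proof.
move=> eV eA; apply: sgraph_eq; first exact/setP.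
by apply/setP => e; apply/idP/idP => /eset_adj[u [v [-> uv]]];
   move: uv; rewrite ?eA // -eA.
Qed.

Lemma adj_mkgraph (A : {set V}) E u v :
  adj (mkgraph A E) u v = [&& [set u; v] \in E, u != v, u \in A & v \in A].
Proof.
rewrite /adj /eset /= inE cards2 subUset !sub1set.
by case: (u != v); rewrite ?andbF.
Qed.

Lemma adj_del G v x y : adj (del_vertex G v) x y = [&& adj G x y, x != v & y != v].
Proof.
rewrite adj_mkgraph; case xy: (adj G x y); last by rewrite /adj in xy; rewrite xy.
have [nxy xG yG] := adjP xy; move: xy; rewrite /adj => ->.
by rewrite nxy !inE xG yG !andbT.
Qed.

Lemma vset_del G v : vset (del_vertex G v) = vset G :\ v.
Proof. by []. Qed.

Lemma del_vertexC G u v :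
  del_vertex (del_vertex G u) v = del_vertex (del_vertex G v) u.
Proof.
apply: sgraph_adj_eq => [x|x y]; first by rewrite !inE andbCA.
by rewrite !adj_del -!andbA; case: (adj G x y) => //=; do 4!case: (_ != _).
Qed.

Lemma in_neighbors G u v : (u \in neighbors G v) = adj G v u.
Proof. by rewrite inE. Qed.

Lemma neighbors_del G v x :
  x != v -> neighbors (del_vertex G v) x = neighbors G x :\ v.
Proof. by move=> nxv; apply/setP => y; rewrite !inE adj_del nxv /= andbC. Qed.

Lemma neighbors_sub G v : neighbors G v \subset vset G :\ v.
Proof.
apply/subsetP => u; rewrite !inE => /adjP[nvu _ ->].
by rewrite eq_sym nvu.
Qed.

Lemma simplicialP G v : reflect
  (v \in vset G /\ {in neighbors G v &, forall u w, u != w -> adj G u w})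
  (simplicial G v).
Proof.
apply: (iffP andP) => -[vG cl]; split=> //.
  by move=> u w uN wN; apply/implyP/(forall_inP (forall_inP cl u uN)).
by apply/forall_inP => u uN; apply/forall_inP => w wN; apply/implyP/cl.
Qed.

Lemma simplicial_del G v x : simplicial G x -> x != v -> simplicial (del_vertex G v) x.
Proof.
case/simplicialP=> xG cl nxv; apply/simplicialP; split; first by rewrite !inE nxv.
rewrite neighbors_del // => u w /setD1P[nu uN] /setD1P[nw wN] nuw.
by rewrite adj_del cl // nu.
Qed.

Lemma simplicial_undel G v x :
  simplicial (del_vertex G v) x -> ~~ adj G v x -> simplicial G x.
Proof.
case/simplicialP=> /setD1P[nxv xG] cl vx; apply/simplicialP; split=> // u w.
have N : neighbors G x = neighbors (del_vertex G v) x.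
  rewrite neighbors_del //; apply/setP => y; rewrite !inE.
  by case: eqP => // ->; rewrite adjC (negbTE vx).
by rewrite N => uN wN /(cl u w uN wN); rewrite adj_del => /andP[].
Qed.

Lemma card_del G v : v \in vset G -> #|vset G| = #|vset (del_vertex G v)|.+1.
Proof. by move=> vG; rewrite vset_del (cardsD1 v) vG. Qed.

Lemma simplicial_in G v : simplicial G v -> v \in vset G.
Proof. by case/simplicialP. Qed.

Lemma two_tree_card G : two_tree G -> 2 <= #|vset G|.
Proof.
elim=> [G0 -> //|G0 v /andP[/simplicial_in vG _] _ IH].
by rewrite (card_del vG) ltnW.
Qed.

Lemma two_tree_pair G u v : two_tree G -> #|vset G| = 2 ->
  u \in vset G -> v \in vset G -> u != v -> adj G u v.
Proof.
case=> [G0 v2 e1 _ uG vG nuv|G0 w /andP[/simplicial_in wG _] tG v2]; last first.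
  by have := two_tree_card tG; move: v2; rewrite (card_del wG) => -[->].
have /cards1P[e eE] : #|eset G0| == 1 by rewrite e1.
have [x [y [ee xy]]] : exists x y, e = [set x; y] /\ adj G0 x y.
  by apply: eset_adj; rewrite eE inE.
have [nxy xG yG] := adjP xy.
have VE : vset G0 = [set u; v].
  apply/esym/eqP; rewrite eqEcard subUset !sub1set uG vG cards2 nuv v2.
  by [].
move: xG yG nxy xy; rewrite VE !inE => /orP[]/eqP-> /orP[]/eqP->; rewrite ?eqxx //.
by rewrite adjC.
Qed.

Lemma two_tree_mindeg G v : two_tree G -> 3 <= #|vset G| -> v \in vset G ->
  2 <= #|neighbors G v|.
Proof.
move=> tG; elim: tG v => [G0 -> //|G0 w sw tG IH v].
have /andP[/simplicial_in wG /eqP dw] := sw.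
rewrite (card_del wG) ltnS => c2 vG; have [->|nvw] := eqVneq v w; first by rewrite dw.
have vG' : v \in vset (del_vertex G0 w) by rewrite !inE nvw.
have [c3|] := leqP 3 #|vset (del_vertex G0 w)|.
  by apply: leq_trans (IH v c3 vG') _; rewrite neighbors_del // subset_leq_card // subD1set.
rewrite ltnS => le2; have c2' : #|vset (del_vertex G0 w)| = 2 by apply/eqP; rewrite eqn_leq le2.
have Nw : neighbors G0 w = vset (del_vertex G0 w).
  by apply/eqP; rewrite eqEcard neighbors_sub dw c2'.
have /set0Pn[z] : vset (del_vertex G0 w) :\ v != set0.
  by rewrite -card_gt0; move: c2'; rewrite (cardsD1 v) vG' add1n => -[->].
case/setD1P=> nzv zG'.
have vz : adj (del_vertex G0 w) v z by apply: two_tree_pair => //; rewrite eq_sym.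
apply: leq_trans (_ : #|[set w; z]| <= _).
  by rewrite cards2; move: zG'; rewrite !inE eq_sym => /andP[->].
apply: subset_leq_card; rewrite subUset !sub1set !in_neighbors.
by move: vz; rewrite adj_del => /andP[-> _]; rewrite adjC -in_neighbors Nw vG'.
Qed.

(** A clique through the last added vertex consists of that vertex and some of its two neighbors. *)
Lemma two_tree_clique G (K : {set V}) : two_tree G -> K \subset vset G ->
  {in K &, forall u v, u != v -> adj G u v} -> #|K| <= 3.
Proof.
move=> tG; elim: tG K => [G0 c2 _ K KG _|G0 w /andP[sw /eqP dw] _ IH K KG cl].
  by rewrite (leq_trans (subset_leq_card KG)) // c2.
have [wK|wK] := boolP (w \in K).
  rewrite (cardsD1 w) wK add1n ltnS -dw subset_leq_card //.
  by apply/subsetP => x /setD1P[nxw xK]; rewrite in_neighbors cl // eq_sym.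
apply: IH => [|u v uK vK nuv].
  by rewrite vset_del subsetD1 KG wK.
rewrite adj_del cl //=; apply/andP; split; apply: contraNneq wK => <- //.
Qed.

(** A third neighbor would give a clique on four vertices. *)
Lemma two_tree_simplicial2 G v : two_tree G -> 3 <= #|vset G| ->
  simplicial G v -> #|neighbors G v| = 2.
Proof.
move=> tG c3 /simplicialP[vG cl]; apply/eqP; rewrite eqn_leq two_tree_mindeg // andbT.
have vN : v \notin neighbors G v by rewrite in_neighbors; apply/negP => /adjP[]; rewrite eqxx.
have := @two_tree_clique G (v |: neighbors G v) tG; rewrite cardsU1 vN add1n ltnS.
apply; first by rewrite subUset sub1set vG (subset_trans (neighbors_sub _ _)) ?subD1set.
move=> x y /setU1P[->|xN] /setU1P[->|yN]; rewrite ?eqxx // => nxy; last exact: cl.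
  by rewrite -in_neighbors.
by rewrite adjC -in_neighbors.
Qed.

(** A 2-tree can be dismantled from any simplicial vertex. On at least four vertices [v] is not
    adjacent to the last added vertex [w], so the two deletions do not interfere; the triangle is
    treated directly. *)
Lemma two_tree_del G v : two_tree G -> 3 <= #|vset G| -> simplicial G v ->
  two_tree (del_vertex G v).
Proof.
move=> tG; elim: tG v => [G0 -> //|G0 w sw tG IH v] c3 sv.
have [->//|nvw] := eqVneq v w.
have t0 : two_tree G0 := two_tree_add sw tG.
have /andP[sw' /eqP dw] := sw; have wG := simplicial_in sw'; have vG := simplicial_in sv.
have [c4|] := leqP 4 #|vset G0|; last first.
  rewrite ltnS => le3; have e3 : #|vset G0| = 3 by apply/eqP; rewrite eqn_leq le3.
  have c2 : #|vset (del_vertex G0 v)| = 2 by move: e3; rewrite (card_del vG) => -[].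
  have Nv : neighbors G0 v = vset (del_vertex G0 v).
    by apply/eqP; rewrite eqEcard neighbors_sub (two_tree_simplicial2 t0) // c2.
  apply: two_tree_K2 => //; move/eqP: c2 => /cards2P[x [y [nxy VE]]].
  have xy : adj (del_vertex G0 v) x y.
    have [_ cl] := simplicialP _ _ sv.
    have xV : x \in vset (del_vertex G0 v) by rewrite VE !inE eqxx.
    have yV : y \in vset (del_vertex G0 v) by rewrite VE !inE eqxx orbT.
    rewrite adj_del cl ?Nv //=.
    by move: xV yV; rewrite !inE => /andP[-> _] /andP[-> _].
  apply/eqP/cards1P; exists [set x; y]; apply/setP => e; rewrite inE.
  apply/idP/eqP => [/eset_adj[a [c [-> /adjP[nac]]]]|->//].
  rewrite VE !inE => /orP[]/eqP ea /orP[]/eqP ec; move: nac; rewrite ea ec ?eqxx //.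
  by rewrite setUC.
have cw : 3 <= #|vset (del_vertex G0 w)| by rewrite -ltnS -card_del.
have vw : ~~ adj G0 v w.
  apply/negP => vw; have vG' : v \in vset (del_vertex G0 w) by rewrite !inE nvw.
  have := two_tree_mindeg tG cw vG'; rewrite neighbors_del //.
  have := two_tree_simplicial2 t0 c3 sv.
  by rewrite (cardsD1 w) in_neighbors vw add1n => -[->].
have t' := IH v cw (simplicial_del sv nvw).
apply: (@two_tree_add _ _ w); last by rewrite del_vertexC.
rewrite /simplicial2 simplicial_del //=; last by rewrite eq_sym.
rewrite neighbors_del; last by rewrite eq_sym.
rewrite -dw; apply/eqP/eq_card => x; rewrite !inE; case: eqP => // ->.
by rewrite adjC (negbTE vw).
Qed.

(** Otherwise deleting [u] would leave [v] with a single neighbor in a 2-tree on at least three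
    vertices. *)
Lemma simplicial_nonadj G u v : two_tree G -> 4 <= #|vset G| ->
  simplicial G u -> simplicial G v -> ~~ adj G u v.
Proof.
move=> tG c4 su sv; apply/negP => uv; have [nuv uG vG] := adjP uv.
have t' := two_tree_del tG (ltnW c4) su.
have c3 : 3 <= #|vset (del_vertex G u)| by rewrite -ltnS -card_del.
have vG' : v \in vset (del_vertex G u) by rewrite !inE eq_sym nuv.
have := two_tree_mindeg t' c3 vG'; rewrite neighbors_del 1?eq_sym //.
have := two_tree_simplicial2 tG (ltnW c4) sv.
by rewrite (cardsD1 u) in_neighbors adjC uv add1n => -[->].
Qed.

(** Besides [w], some simplicial vertex of the rest is not a neighbor of [w] and hence stays
    simplicial: two simplicial neighbors of [w] would be adjacent. If the rest is a triangle, its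
    vertex off the neighborhood of [w] serves. *)
Lemma two_simplicials G : two_tree G -> 4 <= #|vset G| ->
  exists u v, [/\ u != v, simplicial G u & simplicial G v].
Proof.
elim=> [G0 -> //|G0 w sw tG IH c4].
have /andP[sw' /eqP dw] := sw; have [wG clw] := simplicialP _ _ sw'.
suff [z sz wz] : exists2 z, simplicial (del_vertex G0 w) z & ~~ adj G0 w z.
  exists w, z; split=> //; last exact: simplicial_undel wz.
  by have := simplicial_in sz; rewrite !inE eq_sym => /andP[].
have [c4'|] := leqP 4 #|vset (del_vertex G0 w)|.
  have [u [v [nuv su sv]]] := IH c4'.
  have [wu|] := boolP (adj G0 w u); last by exists u.
  have [wv|] := boolP (adj G0 w v); last by exists v.
  have := simplicial_nonadj tG c4' su sv.
  rewrite adj_del clw ?in_neighbors //=.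
  by have := simplicial_in su; have := simplicial_in sv; rewrite !inE => /andP[-> _] /andP[-> _].
rewrite ltnS => le3; have e3 : #|vset (del_vertex G0 w)| = 3.
  by apply/eqP; rewrite eqn_leq le3 -ltnS -card_del.
have /subsetPn[z zG' zN] : ~~ (vset (del_vertex G0 w) \subset neighbors G0 w).
  by apply/negP => /subset_leq_card; rewrite e3 dw.
have NE : vset (del_vertex G0 w) :\ z = neighbors G0 w.
  apply/esym/eqP; rewrite eqEcard; apply/andP; split.
    apply/subsetP => x xN; have := subsetP (neighbors_sub G0 w) x xN.
    by move=> xG'; rewrite in_setD1 xG' andbT; apply: contraNneq zN => <-.
  by move: e3; rewrite dw (cardsD1 z) zG' add1n => -[->].
exists z; last by rewrite -in_neighbors.
apply/simplicialP; split=> // x y /(subsetP (neighbors_sub _ _)) + /(subsetP (neighbors_sub _ _)).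
rewrite NE => xN yN nxy; rewrite adj_del clw //=.
have := subsetP (neighbors_sub G0 w) x xN; have := subsetP (neighbors_sub G0 w) y yN.
by rewrite !inE => /andP[-> _] /andP[-> _].
Qed.

End TwoTrees.

(** * Levels of a 2-path *)

Section Strips.
Variable V : finType.
Implicit Types (G H S : sgraph V) (u v x y z g b : V).
Implicit Types (en : level V) (lv : seq (level V)).

Definition unsealed en : bool := hub en != mate en.

(* The breadth-first levels of a 2-path from its simplicial vertex [g] to the
   other one.  They are built from the 2-tree structure and not from the fans of a
   spine: a vertex may lie in three consecutive fans, and then the spine does not
   consist of hubs. *)
Definition strip H g b lv : Prop :=
  [/\ layered (adj H) g lv, covers lv (adj H), vset H =i verts g lv &
      exists en lv', [/\ lv = en :: lv', hub en = b, mate en = b & all unsealed lv']].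

Lemma layered_sub (e e' : rel V) g lv :
  (forall u v, e u v -> e' u v) -> layered e g lv -> layered e' g lv.
Proof.
move=> ee'; elim: lv => //= en lv IH [uL disj [aL pL] att /IH lay].
split=> //; split; last exact: sub_path pL.
by apply: sub_all aL => v; apply: ee'.
Qed.

Definition swap_level en : level V :=
  Level (up en) (up' en) (mate en) (hub en) (layer en).

(** Hub and mate of the newest level may be exchanged because no lower level refers to them yet. *)
Lemma layered_swap e g en lv : unsealed en ->
  layered e g (en :: lv) -> layered e g (swap_level en :: lv).
Proof.
move=> nhm /= [uL disj aL [ee att] lay]; split=> //; split=> //.
have nmh : mate en != hub en by rewrite eq_sym.
case: ee => s [[_ e1]|[e1 _]|[e1 _]]; first by rewrite /unsealed e1 eqxx in nhm.
  by exists s; apply: Or33.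
by exists s; apply: Or32.
Qed.

Lemma simplicial_neighbors H (b : V) (c d : V) : #|neighbors H b| = 2 ->
  c != d -> adj H b c -> adj H b d -> neighbors H b = [set c; d].
Proof.
move=> d2 ncd bc bd; apply/esym/eqP; rewrite eqEcard subUset !sub1set.
by rewrite !in_neighbors bc bd cards2 ncd d2.
Qed.

(** [c] is one of the two neighbors of [b'] in [H']. On a longer row these are the previous vertex
    and the hub above; on a one-vertex row they are hub and mate above, which are distinct because
    there are at least two levels. *)
Lemma strip_extend H g b b' c lv (H' := del_vertex H b) :
  strip H' g b' lv -> b \in vset H -> neighbors H b = [set b'; c] ->
  c != b' -> adj H b' c -> #|neighbors H' b'| = 2 -> 2 <= size lv ->
  exists lv2, strip H g b lv2.
Proof.
move=> [lay cov vG [en [lv0 [lvE hb' mb' uns]]]] bH Nb ncb' b'c d2 s2.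
subst lv; have [uL disj [aL pL] [ee att] lay0] := lay.
have sub u v : adj H' u v -> adj H u v by rewrite adj_del => /andP[].
have Hlay := layered_sub sub lay; have [_ _ [HaL HpL] _ Hlay0] := Hlay.
have nbH' v : v \in vset H' -> v != b by rewrite !inE => /andP[].
have bb' : adj H b b' by rewrite -in_neighbors Nb !inE eqxx.
have bc : adj H b c by rewrite -in_neighbors Nb !inE eqxx orbT.
have b'L : b' \in layer en by rewrite -hb' ends_hub.
have b'H' : b' \in vset H' by rewrite vG verts_cons b'L.
have cH' : c \in vset H'.
  by have [nbc _ cH] := adjP bc; rewrite !inE eq_sym nbc.
have b'c' : adj H' b' c by rewrite adj_del b'c !nbH'.
have bv : b \notin verts g (en :: lv0) by rewrite -vG !inE eqxx.
have bL : b \notin layer en by apply: contra bv; rewrite verts_cons => ->.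
have blv0 : b \notin verts g lv0 by apply: contra bv; rewrite verts_cons orbC => ->.
have edges lv2 : (forall u v, has (fun en => level_edge en u v || level_edge en v u) (en :: lv0)
      -> has (fun en => level_edge en u v || level_edge en v u) lv2) ->
    has (fun en => level_edge en b b') lv2 -> has (fun en => level_edge en b c) lv2 ->
    covers lv2 (adj H).
  move=> old hb'2 hc2 u v uv; have [ub|nub] := eqVneq u b.
    move: uv; rewrite ub -in_neighbors Nb !inE => /orP[]/eqP->.
      by apply: sub_has hb'2 => x ->.
    by apply: sub_has hc2 => x ->.
  have [vb|nvb] := eqVneq v b.
    move: uv; rewrite vb adjC -in_neighbors Nb !inE => /orP[]/eqP->.
      by apply: sub_has hb'2 => x ->; rewrite orbT.
    by apply: sub_has hc2 => x ->; rewrite orbT.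
  by apply/old/cov; rewrite adj_del uv nub.
have VH v : (v \in vset H) = (v == b) || (v \in verts g (en :: lv0)).
  by rewrite -vG !inE; case: eqP => [->|].
have rowE : exists s, layer en = rcons s b'.
  by case: ee => s; rewrite hb' mb' eqxx => -[[-> _]|[]|[]] //; exists s.
have upv := attached_verts lay0 att.
have upL : up en \notin layer en by apply/negP => /disj; case: upv => ->.
(* [b] prolongs the last level when its second neighbor is the hub above. *)
have prolong p : p \in verts g lv0 -> p = up en -> c = p -> exists lv2, strip H g b lv2.
  move=> _ pE cE; exists (Level (up en) (up' en) b b (rcons (layer en) b) :: lv0).
  split; last by exists (Level (up en) (up' en) b b (rcons (layer en) b)), lv0.
  - split=> //=.
    + by rewrite rcons_uniq bL.
    + by move=> v; rewrite mem_rcons inE => /orP[/eqP->|/disj].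
    + split; first by rewrite all_rcons HaL -pE -cE adjC bc.
      by rewrite rcons_path HpL; have [s ->] := rowE; rewrite last_rcons adjC.
    + split=> //=; exists (layer en); by apply: Or31.
  - apply: edges => [u v||] /=.
    + case/orP=> [|->]; last by rewrite orbT.
      rewrite /level_edge /= !mem_rcons !inE => /orP[]/andP[-> /or3P[]->];
        by rewrite ?orbT.
    + by rewrite /level_edge /= !mem_rcons !inE eqxx b'L orbT.
    + by rewrite /level_edge /= !mem_rcons !inE eqxx cE pE eqxx !orbT.
  - move=> v; rewrite VH /verts /= !inE !mem_cat mem_rcons inE -!orbA.
    by rewrite orbCA.
have cN : c \in neighbors H' b' by rewrite in_neighbors.
have b'up : adj H' b' (up en) by rewrite adjC; apply: (allP aL).
have [s rE] := rowE; case/lastP: s rE => [|s prev] rE.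
  have [en0 [lv1 E0]] : exists en0 lv1, lv0 = en0 :: lv1.
    by case: (lv0) s2 => // en0 lv1 _; exists en0, lv1.
  subst lv0; have ne0 : unsealed en0 by case/andP: uns.
  move: (att); rewrite /attached /= (negbTE ne0) => /andP[/eqP up0 /eqP up0'].
  have b'up' : adj H' b' (up' en) by move: pL; rewrite rE /= andbT adjC.
  have nup : up en != up' en by rewrite up0 up0'.
  move: cN; rewrite (simplicial_neighbors d2 nup b'up b'up') !inE => /orP[]/eqP cE.
    by apply: (prolong _ _ _ cE) => //; case: upv.
  (* Here [c] is the mate above. Exchanging hub and mate there makes it the hub, and [b] again
     prolongs the row. *)
  exists [:: Level (up' en) (up en) b b [:: b'; b], swap_level en0 & lv1].
  have Hs := layered_swap ne0 Hlay0.
  split; last first.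
  - exists (Level (up' en) (up en) b b [:: b'; b]), (swap_level en0 :: lv1).
    split=> //; move: uns => /= /andP[_ ->]; rewrite andbT /unsealed /= eq_sym.
    exact: ne0.
  - by move=> v; rewrite VH /verts /= rE !inE; case: (v == b); rewrite /= ?orbT ?orbF.
  - apply: edges => [u v||] /=; last 2 first.
    + by rewrite /level_edge /= !inE !eqxx !orbT.
    + by rewrite /level_edge /= !inE cE !eqxx !orbT.
    case/orP=> [|/orP[|->]]; last by rewrite !orbT.
      rewrite /level_edge /= rE !inE => /orP[]/andP[-> /or3P[]->];
        by rewrite ?orbT.
    rewrite /level_edge /= => /orP[]/andP[-> /or3P[]->]; by rewrite ?orbT.
  split.
  - by rewrite /= inE nbH'.
  - move=> v; rewrite !inE => /orP[]/eqP->.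
      by have := disj b'; rewrite b'L => /(_ isT).
    exact: blv0.
  - rewrite /= [adj H (up' en) b]adjC -{2}cE bc [adj H b' b]adjC bb' !andbT.
    by split; rewrite adjC sub.
  - split; first by exists [:: b']; apply: Or31.
    by rewrite /attached /= eq_sym (negbTE ne0) up0 up0' !eqxx.
  - exact: Hs.
have prevL : prev \in layer en by rewrite rE mem_rcons inE mem_rcons inE eqxx orbT.
have b'prev : adj H' b' prev.
  by move: pL; rewrite rE rcons_path last_rcons adjC => /andP[].
have npu : prev != up en by apply: contraNneq upL => <-.
move: cN; rewrite (simplicial_neighbors d2 npu b'prev b'up) !inE => /orP[]/eqP cE;
  last by apply: (prolong _ _ _ cE) => //; case: upv.
(* Here [c] is the previous vertex of the row, so [b'] and [prev] become hub and mate and [b] opens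
   a new level. *)
exists [:: Level b' prev b b [:: b], Level (up en) (up' en) b' prev (layer en) & lv0].
have nbp := adj_neq b'prev.
split; last first.
- exists (Level b' prev b b [:: b]), (Level (up en) (up' en) b' prev (layer en) :: lv0).
  by split=> //; rewrite /= uns andbT.
- by move=> v; rewrite VH /verts /= !inE mem_cat orbCA.
- apply: edges => [u v||] /=; last 2 first.
  + by rewrite /level_edge /= !inE !eqxx !orbT.
  + by rewrite /level_edge /= !inE cE !eqxx !orbT.
  by case/orP=> [uv|->]; rewrite ?orbT //; apply/orP; right; apply/orP; left.
split.
- by [].
- by move=> v; rewrite inE => /eqP->.
- by rewrite /= !andbT adjC bb' -cE adjC.
- split; first by exists [::]; apply: Or31.
  by rewrite /attached /= (negbTE nbp) !eqxx.
split=> //; split=> //; exists s; apply: Or33.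
by rewrite rE -!cats1 -catA.
Qed.

Lemma two_tree_K3 H x y : two_tree H -> #|vset H| = 3 ->
  x \in vset H -> y \in vset H -> x != y -> adj H x y.
Proof.
move=> tH c3 xH yH nxy; rewrite -in_neighbors.
have -> : neighbors H x = vset H :\ x.
  apply/eqP; rewrite eqEcard neighbors_sub; move: (c3); rewrite (cardsD1 x) xH add1n => -[->].
  by rewrite two_tree_mindeg ?c3.
by rewrite !inE eq_sym nxy.
Qed.

Lemma strip_size2 H g b lv : strip H g b lv -> ~~ adj H g b -> 2 <= size lv.
Proof.
case=> lay _ _ [en [lv1 [lvE hb _ _]]]; rewrite {lv}lvE in lay *.
case: lv1 lay => [|en0 lv1] // [_ _ [/allP aL _] [ee att] _]; apply: contraR => _.
move: att; rewrite /attached /= => /andP[_]; rewrite inE => /eqP <-.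
by apply: aL; rewrite -hb ends_hub.
Qed.

Lemma two_path_card3 H g b : two_tree H -> g != b ->
  (forall v, simplicial H v -> v = g \/ v = b) -> #|vset H| != 3.
Proof.
move=> tH ngb only; apply/eqP => c3.
have /set0Pn[z] : vset H :\: [set g; b] != set0.
  rewrite -card_gt0 cardsD; have := subset_leq_card (subsetIr (vset H) [set g; b]).
  by rewrite c3 cards2 ngb; lia.
rewrite !inE negb_or => /andP[/andP[nzg nzb] zH]; case: (only z).
- apply/simplicialP; split=> // x y; rewrite !in_neighbors.
  by move=> /adjP[_ _ xH] /adjP[_ _ yH]; apply: two_tree_K3.
- by move=> ez; rewrite ez eqxx in nzg.
- by move=> ez; rewrite ez eqxx in nzb.
Qed.

(** Deleting [b] leaves a 2-path again: a new simplicial vertex must be a neighbor of [b], and two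
    of them would be adjacent simplicial vertices. This argument needs four remaining vertices, so a
    remaining triangle is handled by explicit levels. *)
Lemma two_path_strip n H g b : #|vset H| = n -> two_tree H ->
  simplicial H g -> simplicial H b -> g != b ->
  (forall v, simplicial H v -> v = g \/ v = b) -> exists lv, strip H g b lv.
Proof.
elim: n H b => [|n IH] H b cH tH sg sb ngb only.
  by have := two_tree_card tH; rewrite cH.
have gH := simplicial_in sg; have bH := simplicial_in sb.
have [n1|n2] := leqP n 1.
  have c2 : #|vset H| = 2 by have := two_tree_card tH; rewrite cH; lia.
  have VE : vset H = [set g; b].
    by apply/esym/eqP; rewrite eqEcard subUset !sub1set gH bH cards2 ngb c2.
  have gb : adj H g b by apply: two_tree_pair.
  exists [:: Level g g b b [:: b]]; split.
  - split=> //=; first by move=> v; rewrite !inE => /eqP->; rewrite eq_sym.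
      by rewrite gb.
    by split; [exists [::]; apply: Or31 | rewrite /attached /= !inE !eqxx].
  - move=> u v /adjP[nuv]; rewrite VE !inE /= /level_edge /= !inE orbF.
    by move=> /orP[]/eqP eu /orP[]/eqP ev; move: nuv; rewrite eu ev ?eqxx ?orbT.
  - by move=> v; rewrite VE !inE.
  - by exists (Level g g b b [:: b]), [::].
have [n2'|n3] := leqP n 2.
  have c3 : #|vset H| = 3 by rewrite cH; lia.
  by have := two_path_card3 tH ngb only; rewrite c3.
have c4 : 4 <= #|vset H| by rewrite cH.
have ngb' : ~~ adj H g b by apply: simplicial_nonadj.
set H' := del_vertex H b.
have cH' : #|vset H'| = n by move: cH; rewrite (card_del bH) => -[].
have tH' : two_tree H' by apply: two_tree_del; rewrite // ltnW.
have d2 : #|neighbors H b| = 2 by apply: two_tree_simplicial2; rewrite // ltnW.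
have sg' : simplicial H' g by apply: simplicial_del.
have [n4|] := leqP 4 n.
  have [s [s' [nss' ss ss']]] : exists s s', [/\ s != s', simplicial H' s & simplicial H' s'].
    by apply: two_simplicials; rewrite ?cH'.
  have old s0 : simplicial H' s0 -> ~~ adj H b s0 -> s0 = g.
    move=> s0s /(simplicial_undel s0s)/only[//|e].
    by have := simplicial_in s0s; rewrite e !inE eqxx.
  have [b' sb' [bb' ngb2]] : exists2 b', simplicial H' b' & adj H b b' /\ g != b'.
    have [bs|bs] := boolP (adj H b s).
      by exists s => //; split=> //; apply: contraNneq ngb' => ->; rewrite adjC.
    have [bs'|bs'] := boolP (adj H b s').
      by exists s' => //; split=> //; apply: contraNneq ngb' => ->; rewrite adjC.
    by rewrite (old _ ss bs) (old _ ss' bs') eqxx in nss'.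
  have [c cN] : exists c, neighbors H b = [set b'; c] /\ c != b'.
    have : #|neighbors H b :\ b'| == 1.
      by move: d2; rewrite (cardsD1 b') in_neighbors bb' add1n => -[->].
    case/cards1P=> c cE; exists c; have := set11 c; rewrite -cE => /setD1P[ncb' cN].
    by split=> //; rewrite setD1K ?in_neighbors.
  have [Nb ncb'] := cN.
  have bc : adj H b c by rewrite -in_neighbors Nb !inE eqxx orbT.
  have b'c : adj H b' c.
    by have [_ cl] := simplicialP _ _ sb; apply: cl; rewrite ?in_neighbors // eq_sym.
  have [lv st] : exists lv, strip H' g b' lv.
    apply: IH => // v sv; have [bv|/(old _ sv)] := boolP (adj H b v); last by left.
    right; apply/eqP; apply: contraT => nvb'.
    have := simplicial_nonadj tH' _ sv sb'; rewrite cH' n4 => /(_ isT)/negP[].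
    have [_ cl] := simplicialP _ _ sb.
    rewrite adj_del cl ?in_neighbors //= eq_sym (adj_neq bv) eq_sym.
    exact: adj_neq bb'.
  apply: (strip_extend st bH Nb ncb' b'c).
    by apply: two_tree_simplicial2; rewrite ?cH' // ltnW.
  by apply: strip_size2 st _; apply: simplicial_nonadj; rewrite ?cH'.
rewrite ltnS => n3'; have en3 : n = 3 by apply/eqP; rewrite eqn_leq n3'.
move/eqP: (d2) => /cards2P[p [q [npq Nb]]].
have [bp bq] : adj H b p /\ adj H b q by rewrite -!in_neighbors Nb !inE !eqxx orbT.
have inH' v : adj H b v -> v \in vset H'.
  by case/adjP=> nbv _ vH; rewrite !inE eq_sym nbv.
have ngp : g != p by apply: contraNneq ngb' => ->; rewrite adjC.
have ngq : g != q by apply: contraNneq ngb' => ->; rewrite adjC.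
have gH' := simplicial_in sg'; have pH' := inH' _ bp; have qH' := inH' _ bq.
have adjH' x y : x \in vset H' -> y \in vset H' -> x != y -> adj H x y.
  move=> xH' yH' nxy; have : adj H' x y by apply: two_tree_K3; rewrite ?cH'.
  by rewrite adj_del => /andP[].
have VE' : vset H' = [set g; p; q].
  apply/esym/eqP; rewrite eqEcard !subUset !sub1set gH' pH' qH' cH' en3.
  by rewrite -setUA cardsU1 cards2 npq !inE negb_or ngp ngq.
have VE v : (v \in vset H) = [|| v == b, v == g, v == p | v == q].
  rewrite -(setD1K bH) in_setU1 -/(vset H') -[vset H :\ b]/(vset H') VE' !inE.
  by rewrite -!orbA.
have nbp := adj_neq bp; have nbq := adj_neq bq.
exists [:: Level p q b b [:: b]; Level g g p q [:: p; q]]; split.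
- split=> /=.
  + by [].
  + move=> v; rewrite inE => /eqP->.
    by rewrite /verts /= !inE !negb_or (eq_sym b g) ngb nbp nbq.
  + by rewrite (adjC _ p) (adjC _ q) bp bq.
  + split; first by exists [::]; apply: Or31.
    by rewrite /attached /= (negbTE npq) !eqxx.
  split=> //=.
  + by rewrite inE npq.
  + by move=> v; rewrite !inE => /orP[]/eqP->; rewrite eq_sym.
  + by rewrite !adjH'.
  + split; first by exists [::]; apply: Or32.
    by rewrite /attached /= inE !eqxx.
- move=> u v uv; have [nuv uH vH] := adjP uv; move: uH vH nuv uv; rewrite !VE.
  rewrite /= /level_edge /= !inE.
  by do 2![case/or4P=> /eqP->]; rewrite ?eqxx ?orbT // 1?[adj H b g]adjC (negbTE ngb').
- by move=> v; rewrite VE /verts /= !inE; do !case: (_ == _).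
- exists (Level p q b b [:: b]), [:: Level g g p q [:: p; q]]; split=> //=.
  by rewrite /unsealed /= npq.
Qed.

End Strips.
Arguments unsealed {V} en.

(** * Spines *)

Section Spines.
Variable V : finType.
Implicit Types (G H S : sgraph V) (u v x y z g b : V) (p s : seq V).
Implicit Types (en : level V) (lv : seq (level V)).

Lemma dist_le H u v p : path (adj H) u p -> last u p = v -> dist H u v <= size p.
Proof.
move=> pp lp; rewrite leqNgt; apply/negP => lt.
have lt' : size p < size (iota 0 #|V|.+1).
  by apply: leq_trans lt _; rewrite /dist find_size.
rewrite size_iota in lt'; have := before_find 0 lt; rewrite nth_iota // add0n.
by move=> /negbT/existsP[]; exists (in_tuple p); rewrite /= pp lp eqxx.
Qed.

Lemma dist_walk H u v : dist H u v <= #|V| ->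
  exists p, [/\ path (adj H) u p, last u p = v & size p = dist H u v].
Proof.
move=> le; have hs : has (has_walk H u v) (iota 0 #|V|.+1).
  by rewrite has_find size_iota ltnS.
have := nth_find 0 hs; rewrite -/(dist H u v) nth_iota ?ltnS // add0n.
by case/existsP=> p /andP[pp /eqP lp]; exists p; rewrite size_tuple.
Qed.

Lemma rev_walk H u p : path (adj H) u p ->
  path (adj H) (last u p) (rev (belast u p)) /\
  last (last u p) (rev (belast u p)) = u.
Proof.
move=> pp; split.
  by rewrite rev_path (eq_path (e' := adj H)) // => x y; rewrite adjC.
by case: p {pp} => //= y p; rewrite rev_cons last_rcons.
Qed.

Lemma path_edges_cons x y s :
  path_edges [:: x, y & s] = [set x; y] |: path_edges (y :: s).
Proof. by apply/setP => e; rewrite !inE. Qed.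

Lemma path_edges_rcons s x y :
  path_edges (rcons (rcons s x) y) = [set x; y] |: path_edges (rcons s x).
Proof.
elim: s => [|z s IH]; first by rewrite /= path_edges_cons.
have c s' u : exists w s2, rcons s' u = w :: s2 :> seq V.
  by case: s' => [|a s']; [exists u, [::] | exists a, (rcons s' u)].
rewrite !rcons_cons; have [w [s2 e]] := c s x; move: IH; rewrite e rcons_cons.
by rewrite !path_edges_cons => ->; rewrite setUCA.
Qed.

Lemma path_edges_rev s : path_edges (rev s) = path_edges s.
Proof.
elim: s => // x [|y s] // IH; rewrite path_edges_cons -IH !rev_cons.
by rewrite path_edges_rcons setUC [[set y; x]]setUC setUC.
Qed.

Lemma path_graph_rev s : path_graph (rev s) = path_graph s.
Proof.
rewrite /path_graph path_edges_rev; congr mkgraph.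
by apply/setP => x; rewrite !inE mem_rev.
Qed.

Fixpoint depth lv v : nat :=
  if lv is en :: lv' then if v \in layer en then (size lv').+1 else depth lv' v else 0.

Lemma depth_up e g en lv : layered e g (en :: lv) -> all unsealed lv ->
  depth lv (up en) = size lv /\ depth lv (up' en) = size lv.
Proof.
move=> [_ _ _ [_ att] lay] uns; move: att lay; rewrite /attached.
case: lv uns => [|en0 lv] /=; first by [].
case/andP=> /negbTE-> _ /andP[/eqP-> /eqP->] [_ _ _ [ee _] _].
by rewrite ends_hub // ends_mate.
Qed.

Lemma depth_old e g en lv v : layered e g (en :: lv) -> v \in verts g lv ->
  depth (en :: lv) v = depth lv v.
Proof. by move=> [_ disj _ _ _] vlv /=; case: ifP => // /disj; rewrite vlv. Qed.

Lemma depth_edge e g lv u v : layered e g lv -> all unsealed (behead lv) ->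
  has (fun en => level_edge en u v || level_edge en v u) lv ->
  depth lv u <= (depth lv v).+1 /\ depth lv v <= (depth lv u).+1.
Proof.
elim: lv => // en lv IH lay0 uns; have [_ _ _ [_ att] lay] := lay0.
have [d1 d2] := depth_up lay0 uns; have [v1 v2] := attached_verts lay att.
have key w z : level_edge en w z -> depth (en :: lv) w = (size lv).+1 /\
    (depth (en :: lv) z = (size lv).+1 \/ depth (en :: lv) z = size lv).
  case/andP=> wL zE; split; first by rewrite /= wL.
  case/or3P: zE => [zL|/eqP->|/eqP->]; first by left; rewrite /= zL.
    by right; rewrite (depth_old lay0).
  by right; rewrite (depth_old lay0).
case/orP=> [/orP[]/key[-> [->|->]]|uv]; try by split; clear; lia.
have [ulv vlv] := level_edge_verts lay uv.
rewrite !(depth_old lay0) //; apply: IH uv => //.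
by case: (lv) uns => //= ? ? /andP[].
Qed.

Lemma depth_walk H g b lv x p : strip H g b lv -> path (adj H) x p ->
  depth lv x <= depth lv (last x p) + size p /\
  depth lv (last x p) <= depth lv x + size p.
Proof.
case=> lay cov _ [en [lv' [lvE _ _ uns]]].
elim: p x => [|y p IH] x /=; first by rewrite addn0.
case/andP=> /cov xy /IH[le1 le2].
have uns' : all unsealed (behead lv) by rewrite lvE.
by have := depth_edge lay uns' xy; move: le1 le2; clear; lia.
Qed.

Lemma depth_root e g lv : layered e g lv -> depth lv g = 0.
Proof.
elim: lv => //= en lv IH [_ disj _ _ lay]; case: ifP => [/disj|_]; last exact: IH.
by rewrite inE eqxx.
Qed.

Lemma strip_depth H g b lv : strip H g b lv -> depth lv g = 0 /\ depth lv b = size lv.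
Proof.
case=> lay _ _ [en [lv' [lvE hb _ _]]]; split; first exact: depth_root lay.
by subst lv; case: lay => _ _ _ [ee _] _; rewrite /= -hb ends_hub.
Qed.

Lemma strip_up_walk H g en lv : layered (adj H) g (en :: lv) -> all unsealed lv ->
  exists p, [/\ path (adj H) (hub en) p, last (hub en) p = g & size p = (size lv).+1].
Proof.
elim: lv en => [|en0 lv IH] en lay uns; have [_ _ [aL _] [ee att] lay'] := lay.
  exists [:: up en]; rewrite /= adjC (allP aL) ?ends_hub //; split=> //.
  by move: att; rewrite /attached inE /= => /andP[_ /eqP].
have [p [pp lp sp]] := IH en0 lay' (proj2 (andP uns)).
move: att; rewrite /attached /= (negbTE (proj1 (andP uns))) => /andP[/eqP ue _].
exists (up en :: p); rewrite /= adjC (allP aL) ?ends_hub // ue pp lp sp.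
by [].
Qed.

Lemma strip_walk H g b lv : strip H g b lv ->
  exists p, [/\ path (adj H) b p, last b p = g & size p = size lv].
Proof.
by case=> lay _ _ [en [lv' [e <- _ uns]]]; subst lv; apply: strip_up_walk.
Qed.

(** The depth changes by at most one along an edge, and the hubs form a walk with one edge per
    level. So the number of levels is the distance from [g] to [b], and a shortest path has that
    length. A spine recorded from [b] to [g] is reversed. *)
Lemma spine_path H S g b lv : two_tree H -> simplicial H g -> simplicial H b ->
  g != b -> (forall v, simplicial H v -> v = g \/ v = b) ->
  strip H g b lv -> spine H S ->
  exists xs, [/\ path (adj H) g xs, last g xs = b, uniq (g :: xs),
                 size xs = size lv & S = path_graph (g :: xs)].
Proof.
move=> tH sg sb ngb only st; have [dg db] := strip_depth st.
have gH := simplicial_in sg; have bH := simplicial_in sb.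
case=> [[diam1 ->]|].
  have le1 : dist H g b <= 1.
    rewrite -diam1 /diam; apply: leq_trans (leq_bigmax_cond _ gH).
    exact: (leq_bigmax_cond (F := fun v => dist H g v) _ bH).
  have [|p [pp lp sp]] := @dist_walk H g b.
    by apply: leq_trans le1 _; apply/card_gt0P; exists g.
  have gb : adj H g b.
    case: p pp lp sp => [|x [|y p]] //=; first by move=> _ /eqP; rewrite (negbTE ngb).
      by rewrite andbT => gx <-.
    by move=> _ _ sp; move: le1; rewrite -sp.
  (* Adjacent simplicial vertices exclude four or more vertices, and a triangle has three simplicial
     ones. *)
  have c2 : #|vset H| = 2.
    have lt4 : #|vset H| < 4.
      by rewrite ltnNge; apply/negP => c4; have := simplicial_nonadj tH c4 sg sb; rewrite gb.
    have := two_tree_card tH; have := two_path_card3 tH ngb only; move: lt4.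
    by clear; lia.
  have VE : vset H = [set g; b].
    by apply/esym/eqP; rewrite eqEcard subUset !sub1set gH bH cards2 ngb c2.
  have pgb : path (adj H) g [:: b] by rewrite /= gb.
  have [_] := depth_walk st pgb; rewrite /= dg db add0n => le.
  have s1 : size lv = 1.
    by case: st => _ _ _ [en [lv' [e _ _ _]]]; subst lv; case: (lv') le.
  exists [:: b]; rewrite s1 /= inE ngb gb; split=> //.
  apply: sgraph_adj_eq => [v|u v]; first by rewrite VE !inE.
  rewrite adj_mkgraph path_edges_cons !inE /= orbF; apply/idP/idP.
    move=> uv; have [nuv] := adjP uv; rewrite nuv VE !inE.
    move=> /orP[]/eqP ue /orP[]/eqP ve; move: nuv; rewrite ue ve !eqxx ?orbT //.
    by rewrite setUC eqxx.
  case/and4P=> _ nuv /orP[]/eqP ue /orP[]/eqP ve; move: nuv; rewrite ue ve ?eqxx //.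
  by rewrite adjC.
case=> a [b0 [xs [vs /=]]].
case=> [[sa sb0 _ d2] [pxs lxs sxs] _ _ [_ ->]].
have nab : a != b0.
  by apply: contraTneq d2 => <-; rewrite -ltnNge (@leq_ltn_trans 0) // (@dist_le H a a [::]).
have ends : (a = g /\ b0 = b) \/ (a = b /\ b0 = g).
  by move: nab; case: (only a sa) => ->; case: (only b0 sb0) => ->; rewrite ?eqxx //; [left|right].
have [w [pw lw sw]] := strip_walk st.
have shortest p : path (adj H) a p -> last a p = b0 -> size lv <= size p.
  move=> pp lp; have [le1 le2] := depth_walk st pp.
  by case: ends lp le1 le2 => -[-> ->] ->; rewrite dg db.
have dle : dist H a b0 <= size lv.
  case: ends => -[-> ->]; last by rewrite -sw dist_le.
  have [pr lr] := rev_walk pw; rewrite lw in pr lr.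
  by rewrite -sw -[size w](size_belast b) -size_rev dist_le.
have sE : size xs = size lv.
  by apply/eqP; rewrite eqn_leq shortest // sxs dle.
(* Cutting out a repetition would give a path shorter than the distance. *)
have uxs : uniq (a :: xs).
  case: (shortenP pxs) (lxs) => p pp up_p sub lp.
  have := shortest p pp lp; rewrite -sE => le.
  apply: (leq_size_uniq up_p) => // z; rewrite !inE => /orP[->//|/sub->].
  by rewrite orbT.
case: ends => -[ea eb]; rewrite ea ?eb in pxs lxs uxs *; first by exists xs.
have [pr lr] := rev_walk pxs; rewrite lxs in pr lr.
have rE : g :: rev (belast b xs) = rev (b :: xs) by rewrite [b :: xs]lastI rev_rcons lxs.
have ur : uniq (g :: rev (belast b xs)) by rewrite rE rev_uniq.
by exists (rev (belast b xs)); rewrite size_rev size_belast rE path_graph_rev.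
Qed.

End Spines.

(** * Blocks *)

Section Blocks.
Variable V : finType.
Implicit Types (G H K B : sgraph V) (u v x y z g b r : V) (p : seq V).

Lemma subgraph_refl G : subgraph G G.
Proof. by rewrite /subgraph !subxx. Qed.

Lemma subgraph_trans H G K : subgraph G H -> subgraph H K -> subgraph G K.
Proof.
case/andP=> v1 e1 /andP[v2 e2].
by rewrite /subgraph (subset_trans v1 v2) (subset_trans e1 e2).
Qed.

Lemma subgraph_anti G H : subgraph G H -> subgraph H G -> G = H.
Proof.
case/andP=> v1 e1 /andP[v2 e2].
by apply: sgraph_eq; apply/eqP; rewrite eqEsubset ?v1 ?e1.
Qed.

Lemma subgraphP H G : reflect
  ({subset vset H <= vset G} /\ (forall u v, adj H u v -> adj G u v)) (subgraph H G).
Proof.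
apply: (iffP andP) => -[sv se]; split; try exact/subsetP.
  by move=> u v; apply: (subsetP se).
by apply/subsetP => e /eset_adj[u [v [-> /se]]].
Qed.

Lemma in_vset_union (s : seq (sgraph V)) v :
  (v \in vset (union_graph s)) = has (fun H => v \in vset H) s.
Proof.
rewrite /vset /=; elim: s => [|H s IH]; first by rewrite big_nil inE.
by rewrite big_cons inE IH.
Qed.

Lemma adj_union (s : seq (sgraph V)) u v :
  adj (union_graph s) u v = has (fun H => adj H u v) s.
Proof.
have e : ([set u; v] \in \bigcup_(H <- s) eset H) = has (fun H => adj H u v) s.
  by elim: s => [|H s IH]; rewrite ?big_nil ?inE // big_cons inE IH.
rewrite adj_mkgraph e; case: hasP => //= -[H Hs uv].
have [-> uH vH] := adjP uv; have := in_vset_union s; rewrite /vset /= => iE.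
by rewrite !iE; apply/andP; split; apply/hasP; exists H.
Qed.

Lemma del_out G z : z \notin vset G -> del_vertex G z = G.
Proof.
move=> zG; apply: sgraph_adj_eq => [v|u v].
  by rewrite !inE; case: eqP => // ->; rewrite (negbTE zG).
rewrite adj_del; case uv: (adj G u v) => //=; have [_ uG vG] := adjP uv.
by apply/andP; split; [apply: contraNneq zG => <-|apply: contraNneq zG => <-].
Qed.

Lemma connectedP G : reflect
  ((exists v, v \in vset G) /\ {in vset G &, forall u v, connect (adj G) u v})
  (connected G).
Proof.
apply: (iffP andP) => -[ne cG]; split.
- exact/set0Pn.
- by move=> u v uG vG; apply: (forall_inP (forall_inP cG u uG)).
- exact/set0Pn.
- by apply/forall_inP => u uG; apply/forall_inP => v vG; apply: cG.
Qed.

Lemma adj_connectC G : connect_sym (adj G).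
Proof. by apply: sym_connect_sym => u v; apply: adjC. Qed.

Lemma connect_del G z u v : connect (adj (del_vertex G z)) u v -> connect (adj G) u v.
Proof.
apply: connect_sub => x y; rewrite adj_del => /and3P[xy _ _].
exact: connect1.
Qed.

Lemma connect_adj_sub G H u v : (forall x y, adj G x y -> adj H x y) ->
  connect (adj G) u v -> connect (adj H) u v.
Proof. by move=> GH; apply: connect_sub => x y /GH/connect1. Qed.

Lemma nonseparableP G : reflect
  (connected G /\
   forall z, {in vset G &, forall u v, u != z -> v != z ->
     connect (adj (del_vertex G z)) u v}) (nonseparable G).
Proof.
apply: (iffP andP) => [[cG nocut]|[cG del]]; split=> //.
  move=> z u v uG vG nuz nvz; have [_ conn] := connectedP _ cG.
  have [zG|zG] := boolP (z \in vset G); last by rewrite del_out // conn.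
  apply: contraT => nconn; have /negP[] := forallP nocut z.
  rewrite /cut_vertex zG; apply/exists_inP; exists u; first by rewrite !inE nuz.
  by apply/exists_inP; exists v; rewrite ?inE ?nvz // conn.
apply/forallP => z; apply/negP => /andP[zG /exists_inP[x /setD1P[nx xG]]].
by case/exists_inP=> y /setD1P[ny yG] /andP[_ /negP[]]; apply: del.
Qed.

(** The condition under which adding [K] keeps [H] nonseparable. It covers paths with two distinct
    ends in [H] as well as nonseparable graphs sharing two vertices with [H]. *)
Definition clings H K : Prop :=
  forall z x, x \in vset K -> x != z ->
    exists y, [/\ y \in vset H, y != z & connect (adj (del_vertex K z)) x y].

Lemma nonseparable_join H K : nonseparable H -> clings H K ->
  nonseparable (union_graph [:: H; K]).
Proof.
move=> /nonseparableP[cH delH] cl; set U := union_graph _.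
have [[h hH] connH] := connectedP _ cH.
have UV v : (v \in vset U) = (v \in vset H) || (v \in vset K).
  by rewrite in_vset_union /= orbF.
have HU x y : adj H x y -> adj U x y by rewrite adj_union /= => ->.
have KU x y : adj K x y -> adj U x y by rewrite adj_union /= => ->; rewrite orbT.
have delU K' z : (forall x y, adj K' x y -> adj U x y) ->
    forall x y, adj (del_vertex K' z) x y -> adj (del_vertex U z) x y.
  by move=> K'U x y; rewrite !adj_del => /and3P[/K'U-> -> ->].
have toH z x : x \in vset U -> x != z ->
    exists y, [/\ y \in vset H, y != z & connect (adj (del_vertex U z)) x y].
  rewrite UV => /orP[xH nxz|xK nxz]; first by exists x.
  have [y [yH nyz xy]] := cl z x xK nxz; exists y; split=> //.
  exact: connect_adj_sub (delU _ _ KU) xy.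
have conn z : {in vset U &, forall u v, u != z -> v != z ->
    connect (adj (del_vertex U z)) u v}.
  move=> u v uU vU nuz nvz.
  have [x [xH nxz ux]] := toH z u uU nuz; have [y [yH nyz vy]] := toH z v vU nvz.
  apply: connect_trans ux _; rewrite adj_connectC in vy; apply: connect_trans vy.
  by apply: connect_adj_sub (delU _ _ HU) _; apply: delH.
apply/nonseparableP; split=> //; apply/connectedP; split.
  by exists h; rewrite UV hH.
have toh x : x \in vset U -> connect (adj U) x h.
  have [->//|nxh xU] := eqVneq x h; move: (xU); rewrite UV => /orP[xH|xK].
    exact: connect_adj_sub HU (connH x h xH hH).
  have [y [yH _ xy]] := cl h x xK nxh.
  apply: connect_trans (connect_adj_sub KU (connect_del xy)) _.
  exact: connect_adj_sub HU (connH y h yH hH).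
move=> u v uU vU; apply: connect_trans (toh u uU) _.
by rewrite adj_connectC toh.
Qed.

(** The union of [B] and [K] is nonseparable, so it equals [B] by maximality. *)
Lemma block_absorbs G B K : block G B -> subgraph K G -> clings B K -> subgraph K B.
Proof.
case/and3P=> BG nB /forallP maxB KG cl; set U := union_graph [:: B; K].
have /subgraphP[vB aB] := BG; have /subgraphP[vK aK] := KG.
have : [&& subgraph U G, nonseparable U & subgraph B U].
  apply/and3P; split; last by apply/subgraphP; split=> [v|u v];
      rewrite ?in_vset_union ?adj_union /= => ->.
    apply/subgraphP; split=> [v|u v].
      by rewrite in_vset_union /= orbF => /orP[/vB|/vK].
    by rewrite adj_union /= orbF => /orP[/aB|/aK].
  exact: nonseparable_join.
move/(implyP (maxB U))/eqP => <-.
by apply/subgraphP; split=> [v|u v]; rewrite ?in_vset_union ?adj_union /= => ->; rewrite orbT.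
Qed.

Definition induced G (A : {set V}) : sgraph V := mkgraph A (eset G).

Lemma adj_induced G (A : {set V}) u v :
  adj (induced G A) u v = [&& adj G u v, u \in A & v \in A].
Proof.
rewrite adj_mkgraph; case uv: (adj G u v).
  by rewrite (adj_neq uv) andTb; move: uv; rewrite /adj => ->.
by move: uv; rewrite /adj => ->.
Qed.

Lemma path_del G z x p : z \notin x :: p -> path (adj G) x p ->
  path (adj (del_vertex G z)) x p.
Proof.
elim: p x => //= y p IH x; rewrite inE negb_or => /andP[nzx zp] /andP[xy pp].
rewrite adj_del xy IH // ![_ == z]eq_sym nzx andbT.
by apply: contraNneq zp => ->; rewrite inE eqxx.
Qed.

Lemma path_induced G (A : {set V}) x p : {subset x :: p <= A} ->
  path (adj G) x p -> path (adj (induced G A)) x p.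
Proof.
elim: p x => //= y p IH x sub /andP[xy pp]; rewrite adj_induced xy !sub ?inE ?eqxx ?orbT //=.
apply: IH pp => v vp; apply: sub; by rewrite inE vp orbT.
Qed.

Lemma block_ear G B x p : block G B -> path (adj G) x p -> uniq (x :: p) ->
  x \in vset B -> last x p \in vset B -> x != last x p ->
  subgraph (induced G [set:: x :: p]) B.
Proof.
move=> bB pp uxp xB lB nxl; apply: (block_absorbs bB).
  have /and3P[/subgraphP[vB _] _ _] := bB.
  apply/subgraphP; split=> [v|u v]; last by rewrite adj_induced => /andP[].
  rewrite /vset /= !inE => /orP[/eqP->|vp]; first exact: vB.
  elim: p x pp vp {uxp xB lB nxl} => //= y p IH x /andP[xy pp].
  by rewrite inE => /orP[/eqP->|/(IH y pp)//]; have [] := adjP xy.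
set K := induced _ _.
have pK : path (adj K) x p by apply: path_induced pp => v vp; rewrite in_set.
move=> z v; rewrite in_set => vp nvz; case/splitPl: vp pp uxp lB nxl pK => p1 p2 lp1 _.
rewrite last_cat lp1 => uxp lB nxl; rewrite cat_path lp1 => /andP[pK1 pK2].
(* The path is simple, so [z] lies on at most one side of [v], and the other side leads to an end of
   the path. *)
have [zp|zp] := boolP (z \in x :: p1); last first.
  exists x; split=> //; first by apply: contraNneq zp => ->; rewrite inE eqxx.
  by rewrite adj_connectC; apply/connectP; exists p1; rewrite ?path_del.
have zp2 : z \notin v :: p2.
  rewrite inE negb_or eq_sym nvz.
  by move: uxp; rewrite -cat_cons cat_uniq => /and3P[_ /hasPn/(_ z) h _]; apply/negP => /h/negP.
exists (last v p2); split=> //.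
  by apply: contraNneq zp2 => <-; apply: mem_last.
by apply/connectP; exists p2; rewrite ?path_del.
Qed.

Lemma block_induced G B u v : block G B -> u \in vset B -> v \in vset B ->
  adj G u v -> adj B u v.
Proof.
move=> bB uB vB uv; have nuv := adj_neq uv.
have /subgraphP[_ aB] : subgraph (induced G [set:: [:: u; v]]) B.
  by apply: block_ear; rewrite //= ?uv // inE nuv.
by apply: aB; rewrite adj_induced uv !inE !eqxx orbT.
Qed.

(** Deleting a vertex spares [x] or [y], so each block clings to the other. *)
Lemma block_eq G B B' x y : block G B -> block G B' -> x != y ->
  x \in vset B -> y \in vset B -> x \in vset B' -> y \in vset B' -> B = B'.
Proof.
move=> bB bB' nxy xB yB xB' yB'.
have one C C' : block G C -> block G C' -> x \in vset C -> y \in vset C ->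
    x \in vset C' -> y \in vset C' -> subgraph C' C.
  move=> bC bC' xC yC xC' yC'; apply: (block_absorbs bC); first by case/and3P: bC'.
  have /and3P[_ /nonseparableP[_ del] _] := bC'.
  move=> z v vC' nvz; have [exz|nxz] := eqVneq x z; last by exists x; rewrite del.
  by exists y; rewrite del // -exz // eq_sym.
by apply: subgraph_anti; apply: one.
Qed.

Lemma block_extends G H : subgraph H G -> nonseparable H ->
  exists B, block G B /\ subgraph H B.
Proof.
move=> HG nH; pose P B := [&& subgraph B G, nonseparable B & subgraph H B].
have PH : P H by rewrite /P HG nH subgraph_refl.
case: (@arg_maxnP _ H P (fun B => #|vset B| + #|eset B|) PH) => B /and3P[BG nB HB] maxB.
exists B; split=> //; apply/and3P; split=> //; apply/forallP => B'; apply/implyP.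
case/and3P=> B'G nB' BB'; have := maxB B'; rewrite /P B'G nB' (subgraph_trans HB BB') => /(_ isT).
case/andP: BB' => sv se le; apply/eqP/sgraph_eq; apply/eqP; rewrite eq_sym eqEcard ?sv ?se /=.
  by have := subset_leq_card se; move: le; clear; rewrite /geq /=; lia.
by have := subset_leq_card sv; move: le; clear; rewrite /geq /=; lia.
Qed.

Lemma edge_block G u v : adj G u v ->
  exists B, [/\ block G B, u \in vset B & v \in vset B].
Proof.
move=> uv; have [nuv uG vG] := adjP uv; set K := induced G [set u; v].
have KA : adj K u v by rewrite adj_induced uv !inE !eqxx orbT.
have KA' : adj K v u by rewrite adjC.
have KV x : (x \in vset K) = (x == u) || (x == v) by rewrite !inE.
have [|| B [bB /subgraphP[KB _]]] := @block_extends G K.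
- apply/subgraphP; split=> [x|x y]; first by rewrite KV => /orP[]/eqP->.
  by rewrite adj_induced => /andP[].
- apply/nonseparableP; split.
    apply/connectedP; split; first by exists u; rewrite KV eqxx.
    move=> x y; rewrite !KV => /orP[]/eqP-> /orP[]/eqP-> //; exact: connect1.
  move=> z x y; rewrite !KV => /orP[]/eqP-> /orP[]/eqP-> // nuz nvz;
    by apply: connect1; rewrite adj_del ?KA ?KA' ?nuz ?nvz.
by exists B; rewrite !KB ?KV ?eqxx ?orbT.
Qed.

Lemma vertex_block G v : v \in vset G -> exists B, block G B /\ v \in vset B.
Proof.
move=> vG; set K := induced G [set v].
have [|| B [bB /subgraphP[KB _]]] := @block_extends G K.
- apply/subgraphP; split=> [x|x y]; first by rewrite inE => /eqP->.
  by rewrite adj_induced => /andP[].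
- apply/nonseparableP; split.
    apply/connectedP; split; first by exists v; rewrite inE.
    by move=> x y; rewrite !inE => /eqP-> /eqP->.
  by move=> z x y; rewrite !inE => /eqP-> /eqP->.
by exists B; rewrite KB ?inE.
Qed.

Lemma block_connected G B : block G B -> connected B.
Proof. by case/and3P=> _ /andP[]. Qed.

(** Let [y] be a neighbor of [v] in [B']. A path from [B] to [y] avoiding [v] would, together with
    the edge back to [v], be an ear of [B]; then [v] and [y] would lie in both blocks. *)
Lemma shared_cut_vertex G B B' v : connected G -> block G B -> block G B' ->
  B != B' -> 2 <= #|vset B| -> 2 <= #|vset B'| ->
  v \in vset B -> v \in vset B' -> cut_vertex G v.
Proof.
move=> cG bB bB' nBB' c2 c2' vB vB'.
have [/subgraphP[sB aB] /subgraphP[sB' aB']] : subgraph B G /\ subgraph B' G.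
  by case/and3P: bB; case/and3P: bB'.
have other (C : sgraph V) : 2 <= #|vset C| -> v \in vset C ->
    exists2 x, x \in vset C & x != v.
  rewrite (cardsD1 v) => + vC; rewrite vC add1n ltnS => /card_gt0P[x].
  by rewrite !inE => /andP[nx xC]; exists x.
have [x xB nxv] := other B c2 vB; have [y0 y0B' ny0v] := other B' c2' vB'.
have [y yv] : exists y, adj B' v y.
  have [_ conn] := connectedP _ (block_connected bB').
  have /connectP[[|y p] /=] := conn v y0 vB' y0B'.
    by move=> _ ey; rewrite ey eqxx in ny0v.
  by case/andP=> vy _ _; exists y.
have [nvy _ yB'] := adjP yv; have [_ connG] := connectedP _ cG.
rewrite /cut_vertex sB //; apply/exists_inP; exists x; first by rewrite !inE nxv sB.
apply/exists_inP; exists y; first by rewrite !inE eq_sym nvy sB'.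
apply/andP; split; first by apply: connG; [apply: sB | apply: sB'].
apply/negP => /connectP[p0 pp0 ly].
case: (shortenP pp0) ly => p pp uxp _ ly.
have vp : v \notin x :: p.
  rewrite inE negb_or eq_sym nxv; apply/negP => vp.
  elim: p x pp vp {uxp ly nxv xB pp0} => //= w p IH x /andP[xw pp].
  rewrite inE => /orP[/eqP ve|]; last exact: IH pp.
  by move: xw; rewrite adj_del -ve eqxx !andbF.
have ppG : path (adj G) x (rcons p v).
  rewrite rcons_path -ly adjC aB' // andbT.
  by apply: sub_path pp => a c; rewrite adj_del => /andP[].
have /subgraphP[sub _] : subgraph (induced G [set:: x :: rcons p v]) B.
  apply: (block_ear bB) => //; rewrite ?last_rcons //.
  by rewrite -rcons_cons rcons_uniq vp.
have yB : y \in vset B.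
  by apply: sub; rewrite inE -rcons_cons mem_rcons inE ly mem_last orbT.
by case/eqP: nBB'; apply: (block_eq bB bB' nvy).
Qed.


(** * Listing the blocks outwards from the root *)

Implicit Types bl : seq (V * sgraph V).

Definition reached r bl v : bool := (v == r) || has (fun q => v \in vset q.2) bl.

(* Newest block first, each paired with the vertex where it is attached. *)
Fixpoint rooted G r bl : Prop :=
  if bl is q :: bl' then
    [/\ block G q.2, q.2 \notin [seq s.2 | s <- bl'],
        q.1 \in vset q.2 /\ reached r bl' q.1,
        (forall v, v \in vset q.2 -> reached r bl' v -> v = q.1) &
        rooted G r bl']
  else True.

Definition reached_adj bl u v : bool := has (fun q => adj q.2 u v) bl.

Lemma rooted_block G r bl q : rooted G r bl -> q \in bl -> block G q.2.
Proof.
elim: bl => //= q0 bl IH [bq _ _ _ ro]; rewrite inE => /orP[/eqP->//|].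
exact: IH.
Qed.

Lemma rooted_uniq G r bl : rooted G r bl -> uniq [seq q.2 | q <- bl].
Proof. by elim: bl => //= q bl IH [_ -> _ _ /IH]. Qed.

Lemma reached_adjC bl : connect_sym (reached_adj bl).
Proof.
apply: sym_connect_sym => u v; rewrite /reached_adj.
by apply: eq_has => q; rewrite adjC.
Qed.

Lemma reached_connect G r bl v : rooted G r bl -> reached r bl v ->
  connect (reached_adj bl) v r.
Proof.
elim: bl v => [|q bl IH] v; first by rewrite /reached orbF => _ /eqP->.
case=> bq _ [gq gr] _ ro.
have up_ x y : connect (reached_adj bl) x y -> connect (reached_adj (q :: bl)) x y.
  apply: connect_sub => a b ab; apply: connect1.
  by rewrite /reached_adj /= -/(reached_adj bl a b) ab orbT.
rewrite /reached /= orbCA => /orP[vq|]; last by move=> /(IH _ ro)/up_.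
apply: connect_trans (up_ _ _ (IH _ ro gr)).
have [_ conn] := connectedP _ (block_connected bq).
apply: connect_sub (conn v q.1 vq gq) => a b ab.
by apply: connect1; rewrite /reached_adj /= ab.
Qed.

Lemma exit_edge (e : rel V) (a : pred V) x p : path e x p -> a x -> ~~ a (last x p) ->
  exists u v, [/\ e u v, a u & ~~ a v].
Proof.
elim: p x => [|y p IH] x /=; first by move=> _ ->.
case/andP=> xy pp ax nl; have [ay|nay] := boolP (a y); first exact: IH pp ay nl.
by exists x, y.
Qed.

(** An edge leaving the reached part yields an unlisted block meeting it. If such a block met it in
    two vertices, a path through listed blocks would be an ear of it; the first edge of this path
    lies in a listed block, and the two blocks would coincide. *)
Lemma rooted_extend G r bl : connected G -> r \in vset G -> rooted G r bl ->
  size bl < #|blocks G| -> exists q, rooted G r (q :: bl).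
Proof.
move=> cG rG ro lt.
have [B0 bB0 nB0] : exists2 B, block G B & B \notin [seq q.2 | q <- bl].
  apply: contrapT => all_in; move: lt; rewrite ltnNge => /negP[].
  rewrite -(size_map snd) cardE; apply: uniq_leq_size; first exact: enum_uniq.
  move=> B; rewrite mem_enum inE => bB; apply: contrapT => /negP nB.
  by apply: all_in; exists B.
have [B [bB nB [g gB gr]]] : exists B, [/\ block G B, B \notin [seq q.2 | q <- bl] &
    exists2 g, g \in vset B & reached r bl g].
  have [_ connG] := connectedP _ cG.
  have [[v vB0] _] := connectedP _ (block_connected bB0).
  have [vr|nvr] := boolP (reached r bl v); first by exists B0; split=> //; exists v.
  have /subgraphP[sB0 _] : subgraph B0 G by case/and3P: bB0.
  have /connectP[p pp ve] := connG r v rG (sB0 v vB0).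
  have [||u [w [uw ur nwr]]] := @exit_edge _ (reached r bl) r p pp.
  - by rewrite /reached eqxx.
  - by rewrite -ve.
  have [B [bB uB wB]] := edge_block uw; exists B; split=> //; last by exists u.
  apply: contra nwr => /mapP[q qbl BE]; rewrite /reached; apply/orP; right.
  by apply/hasP; exists q; rewrite -?BE.
exists (g, B); split=> // v vB vr; apply/eqP; apply: contraT => nvg.
have con : connect (reached_adj bl) g v.
  apply: connect_trans (reached_connect ro gr) _.
  by rewrite reached_adjC (reached_connect ro).
case/connectP: con => p0 pp0 lv; case: (shortenP pp0) lv => p pp uxp _ lv.
have ppG : path (adj G) g p.
  apply: sub_path pp => a b /hasP[q qbl ab].
  by have /and3P[/subgraphP[_ sq] _ _] := rooted_block ro qbl; apply: sq.
have /subgraphP[subV subA] : subgraph (induced G [set:: g :: p]) B.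
  by apply: (block_ear bB); rewrite // -?lv // eq_sym.
case: p pp lv uxp ppG subV subA => [|w p] /=.
  by move=> _ ev; rewrite ev eqxx in nvg.
case/andP=> /hasP[q qbl gw] _ _ _ _ subV _; have [ngw gq wq] := adjP gw.
have wB : w \in vset B by apply: subV; rewrite in_set !inE eqxx orbT.
case/negP: nB; apply/mapP; exists q => //.
exact: (block_eq bB (rooted_block ro qbl) ngw).
Qed.

Lemma rooted_blocks G r : connected G -> r \in vset G ->
  exists bl, [/\ rooted G r bl, size bl = #|blocks G| &
                forall B, (B \in [seq q.2 | q <- bl]) = (B \in blocks G)].
Proof.
move=> cG rG.
have [bl [ro sz]] : exists bl, rooted G r bl /\ size bl = #|blocks G|.
  suff: forall k, k <= #|blocks G| -> exists bl, rooted G r bl /\ size bl = k.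
    by move/(_ _ (leqnn _)).
  elim=> [_|k IH lt]; first by exists [::].
  have [bl [ro sz]] := IH (ltnW lt).
  have [|q roq] := @rooted_extend G r bl cG rG ro; first by rewrite sz.
  by exists (q :: bl); rewrite /= sz.
exists bl; split=> // B.
have sub : {subset [seq q.2 | q <- bl] <= enum (blocks G)}.
  move=> C /mapP[q qbl ->]; rewrite mem_enum inE.
  exact: rooted_block ro qbl.
have [|_ e] := uniq_min_size (rooted_uniq ro) sub; first by rewrite -cardE size_map sz.
by rewrite -[RHS]mem_enum; apply: e.
Qed.

End Blocks.

(** * Gluing the levels of the blocks *)

Section Gluing.
Variable V : finType.
Implicit Types (G H S : sgraph V) (u v x y z g b r : V) (p s : seq V).
Implicit Types (en : level V) (lv : seq (level V)) (w : V -> nat).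

Lemma verts_cat r lv1 lv2 v :
  (v \in verts r (lv1 ++ lv2)) = (v \in flatten [seq layer en | en <- lv1]) || (v \in verts r lv2).
Proof. by rewrite /verts map_cat flatten_cat !inE mem_cat orbCA. Qed.

Lemma nodes_catr r lv1 lv2 : {subset nodes r lv2 <= nodes r (lv1 ++ lv2)}.
Proof.
move=> v; rewrite /nodes filter_cat map_cat !inE mem_cat => /orP[->|->] //.
by rewrite !orbT.
Qed.

Lemma nodes_catl r g lv1 lv2 v : v \in nodes g lv1 -> g \in nodes r lv2 ->
  v \in nodes r (lv1 ++ lv2).
Proof.
rewrite {1}/nodes inE => /orP[/eqP->|vn _]; first exact: nodes_catr.
by rewrite /nodes filter_cat map_cat inE mem_cat vn orbT.
Qed.

Lemma layered_cat (e : rel V) r g lv1 lv2 : layered e g lv1 -> layered e r lv2 ->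
  g \in nodes r lv2 -> sealed lv2 ->
  {in flatten [seq layer en | en <- lv1], forall v, v \notin verts r lv2} ->
  layered e r (lv1 ++ lv2).
Proof.
elim: lv1 => //= en lv1 IH [uL disj aL [ee att] lay1] lay2 gn sl out.
split=> //.
- move=> v vL; rewrite verts_cat negb_or out ?mem_cat ?vL // andbT.
  by have := disj v vL; rewrite inE negb_or => /andP[].
- split=> //; move: att; rewrite /attached; case: lv1 {disj lay1 out IH} => [|en0 lv1] /=.
    by rewrite sl inE => /andP[-> /eqP->].
  case: ifP => // /eqP h0 /andP[-> un].
  exact: nodes_catl (en0 :: lv1) _ _ un gn.
- by apply: IH => // v vin; apply: out; rewrite mem_cat vin orbT.
Qed.

Lemma cost_eq (e : rel V) t r lv w1 w2 : layered e r lv ->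
  {in verts r lv, w1 =1 w2} -> cost t r lv w1 = cost t r lv w2.
Proof.
elim: lv w1 w2 => [|en lv IH] w1 w2 /=; first by move=> _ ->; rewrite ?inE ?eqxx.
case=> _ _ _ [ee att] lay we; have [upv _] := attached_verts lay att.
have wh : w1 (hub en) = w2 (hub en) by apply: we; rewrite verts_cons ends_hub.
rewrite wh; congr (_ + _); apply: IH => // v vlv; rewrite /reweight wh.
by rewrite !we // verts_cons ?vlv ?upv orbT.
Qed.

Definition head_hub g lv : V := if lv is en :: _ then hub en else g.

Fixpoint chained g lv : bool :=
  if lv is en :: lv' then (up en == head_hub g lv') && chained g lv' else true.

Definition attach_weight g w (m : nat) : V -> nat :=
  fun v => if v == g then maxn (w g) m else w v.

Lemma hubs_rows (e : rel V) g lv : layered e g lv ->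
  all (fun en => hub en \in flatten [seq layer en | en <- lv]) lv.
Proof.
elim: lv => //= en lv IH [_ _ _ [ee _] /IH al]; rewrite mem_cat ends_hub //=.
by apply: sub_all al => en' hv; rewrite mem_cat hv orbT.
Qed.

(** The intermediate hubs have weight 1, so the doubled weight from below always wins. The costs
    form a geometric sum, and [g] receives the last doubling. Only the length of the chain and the
    weight of its far end enter, which makes a block comparable with its spine. *)
Lemma cost_chain (e : rel V) t r g en lv1 lv2 w :
  layered e g (en :: lv1) -> chained g (en :: lv1) -> layered e r lv2 ->
  {in flatten [seq layer en | en <- en :: lv1], forall v, v \notin verts r lv2} ->
  0 < w (hub en) -> all (fun en' => w (hub en') == 1) lv1 ->
  cost t r (en :: lv1 ++ lv2) w
  = w (hub en) * (2 ^ (size lv1).+1).-1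
    + cost t r lv2 (attach_weight g w (2 ^ (size lv1).+1 * w (hub en))).
Proof.
move=> + + lay2; elim: lv1 en w => [|en0 lv1 IH] en w.
  move=> _ /= /andP[/eqP upg _] _ _ _; rewrite muln1; congr (_ + _).
  by apply: cost_eq lay2 _ => v _; rewrite /reweight /attach_weight upg expn1; case: eqP => [->|].
move=> lay /= /andP[/eqP upE ch] out w0 /andP[/eqP w01 w1].
have [_ disj _ [ee _] lay'] := lay; have [_ disj0 _ [ee0 _] lay1] := lay'.
have nhg0 : hub en0 != g by apply/eqP => ge; have := disj0 _ (ends_hub ee0); rewrite ge inE eqxx.
have w0' : reweight w en (hub en0) = 2 * w (hub en).
  by rewrite /reweight upE eqxx w01; apply/maxn_idPr; lia.
have := IH en0 (reweight w en) lay' ch; rewrite /= w0' => ->.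
- rewrite addnA; congr (_ + _).
    by rewrite [2 ^ _.+2]expnS; have := expn_gt0 2 (size lv1).+1; move: (2 ^ _) => k; nia.
  apply: cost_eq lay2 _ => v vlv; rewrite /attach_weight /reweight upE.
  have nvh0 : v != hub en0.
    apply: contraTneq vlv => ->; apply: out; rewrite /= !mem_cat ends_hub //.
    by rewrite !orbT.
  by rewrite (negbTE nvh0) [g == _]eq_sym (negbTE nhg0) mulnA -expnSr.
- by move=> v vin; apply: out; rewrite /= mem_cat vin orbT.
- by lia.
- have hub_neq : all (fun en' => hub en' != hub en0) lv1.
    apply: sub_all (hubs_rows lay1) => en' hv; apply: contraTneq hv => ->.
    by have := disj0 _ (ends_hub ee0); rewrite inE negb_or => /andP[].
  elim: (lv1) hub_neq w1 => //= en' lv IHl /andP[hv hvs] /andP[wh whs].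
  by rewrite (IHl hvs whs) andbT /reweight upE (negbTE hv).
Qed.

(** The path is listed from its far end towards [g], in the order of levels, so the vertex above [y]
    is the next one in the list, or [g] at its end. *)
Fixpoint spine_levels g s : seq (level V) :=
  if s is y :: s' then
    Level (head g s') (head g s') y y [:: y] :: spine_levels g s'
  else [::].

Lemma spine_levels_rows g s : flatten [seq layer en | en <- spine_levels g s] = s.
Proof. by elim: s => //= y s ->. Qed.

Lemma spine_levels_size g s : size (spine_levels g s) = size s.
Proof. by elim: s => //= y s ->. Qed.

Lemma spine_levels_nodes g s : nodes g (spine_levels g s) = g :: s.
Proof. by rewrite /nodes; congr (_ :: _); elim: s => //= y s IH; rewrite eqxx /= IH. Qed.

Lemma spine_levels_sealed g s : sealed (spine_levels g s).
Proof. by case: s => //= y s; rewrite eqxx. Qed.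

Lemma spine_levels_chained g s : chained g (spine_levels g s).
Proof. by elim: s => //= y s ->; rewrite andbT; case: s => /=. Qed.

Lemma spine_levels_excess g s : total_excess (spine_levels g s) = 0.
Proof.
rewrite /total_excess; elim: s => [|y s IH]; first by rewrite big_nil.
by rewrite /= big_cons IH /excess /= eqxx.
Qed.

Lemma last_rev_head x s : last x (rev s) = head x s.
Proof. by case: s => // y s; rewrite rev_cons last_rcons. Qed.

Lemma spine_levels_layered (e : rel V) g s : uniq (g :: s) -> path e g (rev s) ->
  layered e g (spine_levels g s).
Proof.
elim: s => //= y s IH /and3P[]; rewrite inE negb_or => /andP[ngy gs] ys us.
rewrite rev_cons rcons_path last_rev_head => /andP[ps ey].
split; rewrite /= ?ey //; last by apply: IH; rewrite ?gs.
  by move=> v; rewrite inE => /eqP->; rewrite /verts spine_levels_rows inE negb_or eq_sym ngy.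
split; first by exists [::]; apply: Or31.
rewrite /attached spine_levels_sealed eqxx spine_levels_nodes /=.
by case: (s) => [|z s']; rewrite !inE eqxx ?orbT.
Qed.

Lemma spine_levels_cover g s u v : u != v -> [set u; v] \in path_edges (g :: rev s) ->
  has (fun en => level_edge en u v || level_edge en v u) (spine_levels g s).
Proof.
move=> nuv; elim: s => [|y s IH]; first by rewrite inE.
rewrite rev_cons -rcons_cons lastI path_edges_rcons -lastI last_rev_head.
case/setU1P=> [e|/IH]; last by rewrite /= orbC => ->.
apply/orP; left; rewrite /level_edge /= !inE.
have : u \in [set head g s; y] by rewrite -e !inE eqxx.
have : v \in [set head g s; y] by rewrite -e !inE eqxx orbT.
rewrite !inE => /orP[]/eqP ev /orP[]/eqP eu; move: nuv; rewrite eu ev ?eqxx //= ?orbT //.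
Qed.

Definition thin en : bool :=
  [&& layer en == [:: hub en], up' en == up en & mate en == hub en].

Lemma spine_levels_thin g s : all thin (spine_levels g s).
Proof. by elim: s => //= y s ->; rewrite /thin /= !eqxx. Qed.

(** A thin level adds one edge, from its only vertex to the one above. This edge is new because that
    vertex lies on no older level. *)
Lemma card_eset_thin T r lv : layered (adj T) r lv -> covers lv (adj T) ->
  all thin lv -> #|eset T| = size lv.
Proof.
move=> lay cov th; pose edges := [seq [set up en; hub en] | en <- lv].
have -> : eset T = [set:: edges].
  apply/setP => e; rewrite in_set; apply/idP/idP.
    case/eset_adj=> u [v [-> uv]]; have nuv := adj_neq uv.
    have := cov u v uv; rewrite /edges {cov lay edges uv}.
    elim: lv th => //= en lv IH /andP[/and3P[/eqP rE /eqP uE /eqP mE] th].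
    case/orP=> [|/(IH th) h]; last by rewrite in_cons h orbT.
    have key a c : a != c -> level_edge en a c -> [set a; c] = [set up en; hub en].
      rewrite /level_edge rE uE !inE orbb => nac /andP[/eqP ea /orP[]/eqP ec].
        by rewrite ea ec eqxx in nac.
      by rewrite ea ec setUC.
    rewrite in_cons => /orP[/(key u v nuv)->|/(key v u)]; first by rewrite eqxx.
    by rewrite [[set u; v]]setUC => ->; rewrite ?eqxx // eq_sym.
  rewrite /edges; elim: lv lay {cov th edges} => //= en lv IH [_ _ [/allP aL _] [ee _] lay].
  by rewrite inE => /orP[/eqP->|/(IH lay)//]; apply: aL; rewrite ends_hub.
rewrite cardsE (card_uniqP _) ?size_map // /edges {edges}.
have sub lv' : layered (adj T) r lv' -> forall s0 : {set V},
    s0 \in [seq [set up en; hub en] | en <- lv'] -> {subset s0 <= verts r lv'}.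
  elim: lv' => // en lv' IH [_ _ _ [ee att] lay'] s0; rewrite in_cons => /orP[/eqP->|s0in] v.
    rewrite in_set2 verts_cons => /orP[]/eqP->; last by rewrite ends_hub.
    by have [-> _] := attached_verts lay' att; rewrite orbT.
  by move=> /(IH lay' s0 s0in) vv; rewrite verts_cons vv orbT.
elim: lv lay {cov th} => //= en lv IH [_ disj _ [ee _] lay]; rewrite IH // andbT.
apply/negP => /(sub lv lay)/(_ (hub en)); rewrite !inE eqxx orbT => /(_ isT).
by have := disj _ (ends_hub ee); rewrite inE => /negbTE->.
Qed.

(** Each level has two vertices outside its excess, except the deepest, which has only [b]. This
    missing mate, once per block, produces the term b(G). *)
Lemma strip_excess H g b lv : strip H g b lv ->
  total_excess lv + 2 * size lv = (size (flatten [seq layer en | en <- lv])).+1.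
Proof.
have unsE lv0 : layered (adj H) g lv0 -> all unsealed lv0 ->
    total_excess lv0 + 2 * size lv0 = size (flatten [seq layer en | en <- lv0]).
  elim: lv0 => [|en lv0 IH]; first by rewrite /total_excess big_nil.
  case=> _ _ _ [ee _] lay /= /andP[ne /(IH lay) e].
  rewrite size_cat -e /total_excess big_cons (ends_size ee) -/(unsealed en) ne.
  by rewrite -/(total_excess lv0); clear; lia.
case=> lay _ _ [en [lv' [lvE hb mb uns]]]; rewrite {}lvE in lay *.
case: lay => _ _ _ [ee _] lay; have e := unsE _ lay uns.
rewrite /= size_cat -e /total_excess big_cons (ends_size ee) hb mb eqxx /=.
by rewrite -/(total_excess lv'); clear; lia.
Qed.

Lemma path_mkgraph (A : {set V}) (E : {set {set V}}) x p : {subset x :: p <= A} ->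
  uniq (x :: p) -> path_edges (x :: p) \subset E -> path (adj (mkgraph A E)) x p.
Proof.
elim: p x => //= y p IH x subA /andP[]; rewrite inE negb_or => /andP[nxy _] up_p.
rewrite path_edges_cons subUset sub1set => /andP[xyE subE].
rewrite adj_mkgraph xyE nxy !subA ?inE ?eqxx ?orbT //=; apply: IH => // v vp.
by apply: subA; rewrite inE vp orbT.
Qed.

Lemma path_path_graph x p : uniq (x :: p) -> path (adj (path_graph (x :: p))) x p.
Proof. by move=> up_p; apply: path_mkgraph => // v vp; rewrite in_set. Qed.

Lemma block_data B S g : two_path B -> simplicial B g -> spine B S ->
  exists b lv xs,
    [/\ strip B g b lv, forall v, simplicial B v -> v = g \/ v = b, b != g &
        [/\ last g xs = b, uniq (g :: xs), size xs = size lv,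
            {subset xs <= vset B} & S = path_graph (g :: xs)]].
Proof.
case=> tB c2 sg spS.
have [b sb [ngb only]] : exists2 b, simplicial B b &
    g != b /\ (forall v, simplicial B v -> v = g \/ v = b).
  have : #|[set v | simplicial B v] :\ g| == 1.
    by move: c2; rewrite (cardsD1 g) inE sg add1n => -[->].
  case/cards1P=> b bE; exists b.
    by have := set11 b; rewrite -bE !inE => /andP[].
  split; first by have := set11 b; rewrite -bE !inE eq_sym => /andP[].
  move=> v sv; have [->|nvg] := eqVneq v g; first by left.
  by right; apply/eqP; rewrite -in_set1 -bE !inE nvg.
have [lv st] := two_path_strip erefl tB sg sb ngb only.
have [xs [pxs lxs uxs sxs SE]] := spine_path tB sg sb ngb only st spS.
exists b, lv, xs; split=> //; first by rewrite eq_sym.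
split=> //; move=> v; elim: xs g pxs {lxs uxs sxs SE sg ngb only st} => //= y p IH x.
by case/andP=> /adjP[_ _ yB] pp; rewrite inE => /orP[/eqP->//|/(IH _ pp)].
Qed.

(** Blocks are induced subgraphs, so a vertex simplicial in [G] is simplicial in its blocks;
    cut-vertices are covered by the definition of a semi-2-tree. *)
Lemma root_simplicial G r B : semi_two_tree G ->
  simplicial G r \/ cut_vertex G r -> block G B -> r \in vset B -> simplicial B r.
Proof.
case=> cG _ cut hr bB rB; case: hr => [sr|cr]; last by apply: (cut _ _ cr); rewrite ?inE.
have [_ cl] := simplicialP _ _ sr; apply/simplicialP; split=> // u w.
have /and3P[/subgraphP[_ aB] _ _] := bB.
rewrite !in_neighbors => ru rw nuw; have [_ _ uB] := adjP ru; have [_ _ wB] := adjP rw.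
by apply: (block_induced bB) => //; apply: cl; rewrite ?in_neighbors ?aB.
Qed.

(** An attaching vertex other than [r] lies in two blocks and is therefore a cut-vertex. *)
Lemma attach_simplicial G r q bl : semi_two_tree G ->
  simplicial G r \/ cut_vertex G r -> rooted G r (q :: bl) ->
  forall B, block G B -> q.1 \in vset B -> simplicial B q.1.
Proof.
move=> sG hr [bq nq [gq gr] _ ro] B bB gB; have [cG b2 cut] := sG.
have bG C : block G C -> C \in blocks G by rewrite inE.
have [gE|ngr] := eqVneq q.1 r; first by rewrite gE in gB *; apply: root_simplicial hr bB gB.
move: gr; rewrite /reached (negbTE ngr) => /hasP[q1 q1bl gq1].
have c2 C : block G C -> 2 <= #|vset C|.
  by move/bG/b2=> [tC _]; apply: two_tree_card.
have bq1 := rooted_block ro q1bl.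
apply: (cut _ _ _ (bG _ bB) gB); apply: (shared_cut_vertex cG bq bq1) => //; try exact: c2.
by apply: contraNneq nq => ->; apply: map_f.
Qed.

End Gluing.
Arguments thin {V} en.

(** * Building the levels of [G] and of its skeleton in parallel *)

Section Assembly.
Variable V : finType.
Implicit Types (G H S T B : sgraph V) (u v x y z g b r : V) (p s : seq V).
Implicit Types (en : level V) (lv : seq (level V)) (w : V -> nat).
Implicit Types bl : seq (V * sgraph V).

Definition edge_of_level u v en := level_edge en u v || level_edge en v u.

(** A spine need not run through the hubs, so the two weight functions are compared only at the
    nodes of [G]. Everywhere else nothing has been charged yet and the weights are 1. *)
Definition weights_agree r lvG lvT w1 w2 : Prop :=
  [/\ {in nodes r lvG, w1 =1 w2},
      {in verts r lvG, forall v, v \notin nodes r lvG -> w1 v = 1},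
      {in verts r lvT, forall v, v \notin nodes r lvG -> w2 v = 1} &
      forall v, 0 < w1 v /\ 0 < w2 v].

Definition reached_spine (sp : sgraph V -> sgraph V) r bl v : bool :=
  (v == r) || has (fun q => v \in vset (sp q.2)) bl.

Lemma total_excess_cat lv1 lv2 :
  total_excess (lv1 ++ lv2) = total_excess lv1 + total_excess lv2.
Proof. exact: big_cat. Qed.

Lemma strip_rows H g b lv v : strip H g b lv ->
  (v \in flatten [seq layer en | en <- lv]) = (v \in vset H) && (v != g).
Proof.
case=> lay _ VE _; rewrite VE /verts inE.
have gout : g \notin flatten [seq layer en | en <- lv].
  elim: lv lay {VE} => //= en lv IH [_ disj _ _ lay]; rewrite mem_cat negb_or IH // andbT.
  by apply/negP => /disj; rewrite inE eqxx.
by case: eqP => [->|]; rewrite ?(negbTE gout) ?andbT.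
Qed.

Lemma strip_nodes H g b lv r lv2 v : strip H g b lv ->
  (v \in nodes r (lv ++ lv2)) = (v == b) || (v \in nodes r lv2).
Proof.
case=> _ _ _ [en [lv' [-> hb mb uns]]].
rewrite /nodes filter_cat map_cat !inE mem_cat /= hb mb eqxx /=.
have -> : [seq en0 <- lv' | hub en0 == mate en0] = [::].
  by elim: lv' uns => //= en0 lv' IH /andP[/negbTE-> /IH].
by rewrite in_cons in_nil orbF orbCA hb.
Qed.

Lemma strip_chained (e : rel V) g en lv : layered e g (en :: lv) -> all unsealed lv ->
  chained g (en :: lv).
Proof.
elim: lv en => [|en0 lv IH] en.
  case=> _ _ _ [_ att] _ _ /=; move: att; rewrite /attached /= inE andbT.
  by case/andP.
case=> _ _ _ [_ att] lay uns; have /andP[ne0 uns'] := uns.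
rewrite /= -/(chained g (en0 :: lv)) (IH _ lay uns') andbT.
by move: att; rewrite /attached /= (negbTE ne0) => /andP[].
Qed.

(** A strip and its spine have the same length, so they cost the same and pass the same weight to
    the attaching vertex. Therefore the cost identity, for all agreeing weights, can be proved block
    by block. The clause on simplicial vertices ensures that the next block hangs at a node of both
    lists. *)
Lemma assemble G T r sp bl : semi_two_tree G ->
  simplicial G r \/ cut_vertex G r ->
  (forall B, block G B -> spine B (sp B)) ->
  (forall B, block G B -> subgraph (sp B) T) -> rooted G r bl ->
  exists lvG lvT,
    [/\ [/\ layered (adj G) r lvG, sealed lvG, verts r lvG =i reached r bl &
            forall u v, reached_adj bl u v -> has (edge_of_level u v) lvG],
        [/\ layered (adj T) r lvT, sealed lvT, all thin lvT,
            verts r lvT =i reached_spine sp r bl &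
            forall u v, has (fun q => adj (sp q.2) u v) bl -> has (edge_of_level u v) lvT],
        [/\ (forall v, reached r bl v -> v != r ->
               (forall q, q \in bl -> v \in vset q.2 -> simplicial q.2 v) ->
               v \in nodes r lvG /\ v \in nodes r lvT),
            {subset verts r lvT <= verts r lvG} &
            forall t w1 w2, weights_agree r lvG lvT w1 w2 ->
              cost t r lvG w1 = cost t r lvT w2],
        total_excess lvG + 2 * size lvT
          = size (flatten [seq layer en | en <- lvG]) + size bl &
        total_excess lvT = 0].
Proof.
move=> sG hr spines spT; elim: bl => [_|q bl IH ro0].
  exists [::], [::]; split=> //.
  - split=> //.
    by move=> t w1 w2 [eqn _ _ _]; rewrite /= eqn // inE eqxx.
  - by rewrite /total_excess big_nil.
  - by rewrite /total_excess big_nil.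
have [bq nq [gq gr] uniq_g ro] := ro0.
have [lvG [lvT [[layG slG VG EG] [layT slT thT VT ET] [nod VTG costE] exG exT]]] := IH ro.
have [cG b2 _] := sG; set g := q.1 in gq gr uniq_g *.
have sg : simplicial q.2 g by apply: (attach_simplicial sG hr ro0).
have b2q : two_path q.2 by apply: b2; rewrite inE.
have [b [lv [xs [st only nbg [lxs uxs sxs xsB SE]]]]] := block_data b2q sg (spines _ bq).
(* Either [g] is the root, or it is simplicial in every listed block containing it and hence an end
   of a spine. *)
have gnod : g \in nodes r lvG /\ g \in nodes r lvT.
  have [->|ngr] := eqVneq g r; first by rewrite !inE eqxx.
  apply: (nod g gr ngr) => q' q'bl gq'.
  exact: (attach_simplicial sG hr ro0 (rooted_block ro q'bl)).
have [gnG gnT] := gnod.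
have [layB covB VB [en [lv1 [lvE hb mb uns]]]] := st.
have /subgraphP[VqG AqG] : subgraph q.2 G by case/and3P: bq.
have bB : b \in vset q.2.
  by rewrite VB lvE verts_cons -hb ends_hub //; move: layB; rewrite lvE => -[_ _ _ []].
have fresh v : v \in vset q.2 -> v != g -> v \notin verts r lvG.
  by move=> vB nvg; rewrite VG; apply: contra nvg => vr; apply/eqP/uniq_g.
have freshT v : v \in vset q.2 -> v != g -> v \notin verts r lvT.
  by move=> vB nvg; apply: contra (fresh v vB nvg) => /VTG.
have rowsB v : v \in flatten [seq layer en | en <- lv] -> v \in vset q.2 /\ v != g.
  by rewrite (strip_rows _ st) => /andP.
pose lvS := spine_levels g (rev xs).
have rowsS : flatten [seq layer en | en <- lvS] = rev xs by apply: spine_levels_rows.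
have xsE v : v \in xs -> v \in vset q.2 /\ v != g.
  move=> vxs; split; first exact: xsB.
  by apply: contraTneq vxs => ->; case/andP: uxs.
have layS : layered (adj T) g lvS.
  apply: spine_levels_layered; first by move: uxs; rewrite /= mem_rev rev_uniq.
  rewrite revK; have := path_path_graph uxs; apply: sub_path => x y; rewrite -SE.
  by have /subgraphP[_ aT] := spT _ bq; apply: aT.
exists (lv ++ lvG), (lvS ++ lvT); split.
- split.
  + apply: (layered_cat (layered_sub AqG layB) layG gnG slG).
    by move=> v /rowsB[vB nvg]; apply: fresh.
  + by rewrite lvE /= hb mb eqxx.
  + move=> v; rewrite verts_cat (strip_rows _ st) VG.
    rewrite -[v \in reached r bl]/(reached r bl v).
    rewrite -[v \in reached r (q :: bl)]/(reached r (q :: bl) v).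
    have -> : reached r (q :: bl) v = (v \in vset q.2) || reached r bl v.
      by rewrite /reached /= orbCA.
    have [->|_] := eqVneq v g; last by rewrite andbT.
    by rewrite gq gr orbT.
  + move=> u v; rewrite /reached_adj /= has_cat => /orP[/covB->//|/EG->].
    by rewrite orbT.
- split.
  + apply: (layered_cat layS layT gnT slT) => v; rewrite rowsS mem_rev => /xsE[vB nvg].
    exact: freshT.
  + have := spine_levels_sealed g (rev xs); rewrite -/lvS.
    by case: (lvS).
  + by rewrite all_cat spine_levels_thin.
  + have gT : g \in verts r lvT by apply: nodes_verts layT _ gnT.
    move=> v; rewrite verts_cat rowsS mem_rev VT.
    have -> : (v \in reached_spine sp r (q :: bl))
        = (v \in vset (sp q.2)) || (v \in reached_spine sp r bl).
      exact: orbCA.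
    rewrite SE -!VT [v \in vset _]in_set [v \in g :: xs]in_cons.
    by have [->|_] := eqVneq v g; rewrite ?gT ?orbT.
  + move=> u v; rewrite /= has_cat => /orP[|/ET->]; last by rewrite orbT.
    rewrite SE => uv; have nuv := adj_neq uv.
    move: uv; rewrite adj_mkgraph => /andP[uv _]; apply/orP; left.
    by apply: spine_levels_cover; rewrite ?revK.
- split.
  + move=> v vr nvr vs; have [vr'|vr'] := boolP (reached r bl v).
      have [|v1 v2] := nod v vr' nvr.
        by move=> q' q'bl; apply: vs; rewrite inE q'bl orbT.
      by split; apply: nodes_catr.
    have vq : v \in vset q.2.
      move: vr; rewrite /reached /= orbCA -/(reached r bl v) (negbTE vr') orbF.
      by [].
    have /only[vg|->] := vs q (mem_head _ _) vq; first by rewrite vg gr in vr'.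
    split; first by rewrite (strip_nodes _ _ _ st) eqxx.
    apply: nodes_catl gnT; rewrite spine_levels_nodes inE mem_rev -lxs.
    by rewrite -in_cons mem_last.
  + move=> v; rewrite !verts_cat rowsS mem_rev => /orP[/xsE[vB nvg]|/VTG->].
      by rewrite (strip_rows _ st) vB nvg.
    by rewrite orbT.
  + move=> t w1 w2 [w12 w1E w2E wpos].
    have notin v : v \in vset q.2 -> v != g -> v != b -> v \notin nodes r (lv ++ lvG).
      move=> vB nvg nvb; rewrite (strip_nodes _ _ _ st) (negbTE nvb).
      by apply: contra (fresh v vB nvg); apply: nodes_verts layG _.
    (* The hubs between [g] and [b] are not nodes, so nothing hangs there and their weight is still
       1. *)
    have w1B : all (fun en' => w1 (hub en') == 1) lv1.
      have [_ disj _ [ee _] lay1] : layered (adj q.2) g (en :: lv1) by rewrite -lvE.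
      apply: sub_all (hubs_rows lay1) => en' hv.
      have [|hB nhg] := rowsB (hub en'); first by rewrite lvE /= mem_cat hv orbT.
      apply/eqP/w1E; first by rewrite verts_cat (strip_rows _ st) hB nhg.
      apply: notin => //; apply: contraTneq hv => ->; rewrite -hb.
      by have := disj _ (ends_hub ee); rewrite inE negb_or => /andP[].
    have [s xsE'] : exists s, rev xs = b :: s.
      move: lxs nbg; case/lastP: (xs) => [/= <-|s y]; first by rewrite eqxx.
      by rewrite last_rcons => -> _; exists (rev s); rewrite rev_rcons.
    have us : b \notin s.
      have : uniq (rev xs) by rewrite rev_uniq; case/andP: uxs.
      by rewrite xsE' => /andP[].
    have sxsE v : v \in s -> v \in xs by move=> vs; rewrite -mem_rev xsE' inE vs orbT.
    have w2B : all (fun en' => w2 (hub en') == 1) (spine_levels g s).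
      have : all (fun v => w2 v == 1) s.
        apply/allP => v vs; have [vB nvg] := xsE v (sxsE v vs); apply/eqP/w2E.
          by rewrite verts_cat rowsS mem_rev sxsE.
        by apply: notin => //; apply: contraNneq us => <-.
      by elim: (s) => //= y s' IHs /andP[-> /IHs].
    have bn : b \in nodes r (lv ++ lvG) by rewrite (strip_nodes _ _ _ st) eqxx.
    have sz : size (spine_levels g s) = size lv1.
      rewrite spine_levels_size; apply: succn_inj; rewrite -[(size lv1).+1]/(size (en :: lv1)).
      by rewrite -lvE -sxs -[(size s).+1]/(size (b :: s)) -xsE' size_rev.
    have chB : chained g (en :: lv1) by move: layB; rewrite lvE => /strip_chained; apply.
    have layB' := layered_sub AqG layB; rewrite lvE in layB'.
    rewrite lvE cat_cons (cost_chain t layB' chB layG) //; last 2 first.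
    + by rewrite -lvE => v /rowsB[vB nvg]; apply: fresh.
    + by case: (wpos (hub en)).
    move: layS (spine_levels_chained g (rev xs)).
    rewrite -/lvS /lvS xsE' [spine_levels g (b :: s)]/= cat_cons => layS' chS.
    rewrite (cost_chain t layS' chS layT) //; last 2 first.
    + move=> v; rewrite -[_ :: spine_levels g s]/(spine_levels g (b :: s)) -xsE' rowsS.
      by rewrite mem_rev => /xsE[vB nvg]; apply: freshT.
    + by case: (wpos b).
    rewrite [hub (Level _ _ _ _ _)]/= sz hb w12 //; congr (_ + _).
    apply: costE; rewrite /attach_weight; split.
    + move=> v vn; have vn' : v \in nodes r (lv ++ lvG) by apply: nodes_catr.
      by rewrite !w12 //; apply: nodes_catr.
    + move=> v vlv vn; have nvg : v != g by apply: contraNneq vn => ->.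
      rewrite (negbTE nvg) w1E ?verts_cat ?vlv ?orbT //.
      rewrite (strip_nodes _ _ _ st) negb_or vn andbT.
      by apply: contraTneq vlv => ->; apply: fresh.
    + move=> v vlv vn; have nvg : v != g by apply: contraNneq vn => ->.
      rewrite (negbTE nvg) w2E ?verts_cat ?vlv ?orbT //.
      rewrite (strip_nodes _ _ _ st) negb_or vn andbT.
      by apply: contraTneq vlv => ->; apply: freshT.
    + move=> v; have [p1 p2] := wpos v; case: ifP => // _.
      by have [p1' p2'] := wpos g; rewrite !leq_max p1' p2'.
- rewrite total_excess_cat !size_cat map_cat flatten_cat size_cat /=.
  have := strip_excess st; rewrite spine_levels_size size_rev sxs.
  by move: exG; clear; lia.
- by rewrite total_excess_cat exT addn0 spine_levels_excess.
Qed.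

End Assembly.

(** * The formula for semi-2-trees *)

Lemma layered_uniq (V : finType) (e : rel V) r lv : layered e r lv -> uniq (verts r lv).
Proof.
elim: lv => [|en lv IH] //= [uL disj _ _ /IH]; rewrite /verts /= => /andP[rlv ulv].
rewrite mem_cat negb_or rlv andbT cat_uniq uL ulv andbT; apply/andP; split.
  by apply/negP => /disj; rewrite inE eqxx.
by apply/hasPn => v vlv; apply/negP => /disj; rewrite /verts inE vlv orbT.
Qed.

Local Open Scope ring_scope.

Theorem corollary20 (V : finType) (G T : sgraph V) (t : nat) (r : V)
    (hG : semi_two_tree G) (hT : skeleton G T) (ht : (1 <= t)%N)
    (hr : simplicial G r \/ cut_vertex G r) :
  (pebbling_number G t r)%:Z =
    (pebbling_number T t r)%:Z + (#|vset G|%:Z - 1) + #|blocks G|%:Z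
      - 2 * #|eset T|%:Z.
Proof.
have [cG b2 _] := hG; case: hT => sp [spines TE].
have rG : r \in vset G by case: hr => [/simplicial_in|/andP[]].
have [bl [ro szbl blE]] := rooted_blocks cG rG.
have inbl B : block G B -> exists2 q, q \in bl & B = q.2.
  by move=> bB; apply/mapP; rewrite blE inE.
have spines' B : block G B -> spine B (sp B) by move=> bB; apply: spines; rewrite inE.
have TV v : (v \in vset T) = has (fun q => v \in vset (sp q.2)) bl.
  rewrite TE in_vset_union has_map; apply/hasP/hasP => -[].
    by move=> B; rewrite mem_enum inE => /inbl[q qbl ->] vB; exists q.
  move=> q /(rooted_block ro) bq vq; exists q.2 => //.
  by rewrite mem_enum inE.
have TA u v : adj T u v = has (fun q => adj (sp q.2) u v) bl.
  rewrite TE adj_union has_map; apply/hasP/hasP => -[].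
    by move=> B; rewrite mem_enum inE => /inbl[q qbl ->] vB; exists q.
  move=> q /(rooted_block ro) bq vq; exists q.2 => //.
  by rewrite mem_enum inE.
have spT B : block G B -> subgraph (sp B) T.
  move=> /inbl[q qbl ->]; apply/subgraphP; split=> [v vq|u v uv].
    by rewrite TV; apply/hasP; exists q.
  by rewrite TA; apply/hasP; exists q.
have [lvG [lvT [[layG slG VG EG] [layT slT thT VT ET] [_ _ costE] exG exT]]] :=
  assemble hG hr spines' spT ro.
have covG : covers lvG (adj G).
  move=> u v uv; have [B [bB uB vB]] := edge_block uv; apply: EG.
  have [q qbl BE] := inbl B bB; apply/hasP; exists q => //.
  by rewrite -BE; apply: block_induced bB _ _ uv.
have covT : covers lvT (adj T) by move=> u v; rewrite TA => /ET.
have vG : vset G =i verts r lvG.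
  move=> v; rewrite VG; apply/idP/orP => [/vertex_block[B [/inbl[q qbl ->] vq]]|].
    by right; apply/hasP; exists q.
  case=> [/eqP->//|/hasP[q /(rooted_block ro)/and3P[/subgraphP[sq _] _ _]]].
  exact: sq.
have vT : vset T =i verts r lvT.
  move=> v; rewrite VT -[RHS]/(reached_spine sp r bl v) TV /reached_spine.
  (* The list always contains [r]. That [r] lies in [T] follows because it is simplicial in a block
     and hence an end of its spine. *)
  have [->|//] := eqVneq v r.
  have [B [bB rB]] := vertex_block rG; have [q qbl BE] := inbl B bB.
  apply/hasP; exists q => //; rewrite -BE.
  have sr := root_simplicial hG hr bB rB.
  have b2B : two_path B by apply: b2; rewrite inE.
  have [b [lv [xs [_ _ _ [_ _ _ _ ->]]]]] := block_data b2B sr (spines' B bB).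
  by rewrite !inE eqxx.
have cardG : #|vset G| = (size (flatten [seq layer en | en <- lvG])).+1.
  by rewrite (eq_card vG) (card_uniqP (layered_uniq layG)).
rewrite (pebbling_number_layered layG slG covG vG ht).
rewrite (pebbling_number_layered layT slT covT vT ht) exT.
rewrite (costE t (fun=> 1%N) (fun=> 1%N)); last by [].
rewrite (card_eset_thin layT covT thT) cardG -szbl.
(* The rows of [G] contain n - 1 vertices and the levels of the skeleton number e(T), so [exG] says
   that the excess is (n-1) + b(G) - 2e(T). *)
by move: exG; clear; move: (cost _ _ _ _) => c; lia.
Qed.
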